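(* Let $\Lambda_1,\Lambda_2,\Lambda_3$ be groups. Let $\Gamma:=(\Lambda_1*\Lambda_2)\times\Lambda_3$ and $\Lambda:=(\Lambda_1\times\Lambda_2)\times\Lambda_3$, and for $j\in\{1,2\}$ let $f_j\colon\Lambda_1*\Lambda_2\to\Lambda_j$ be the canonical projection to the $j$-th free factor (identity on $\Lambda_j$, trivial on the other free factor). Let $$f\colon\Gamma\to\Lambda,\qquad f(g,\lambda_3):=\bigl((f_1(g),f_2(g)),\lambda_3\bigr).$$ Assume that there exist $n,n_1,n_2,n_3\in\mathbb{N}$ with $n_1+n_2+n_3=n$ and bounded cohomology classes $\varphi_j\in H^{n_j}_b(\Lambda_j;\mathbb{R})$ for $j\in\{1,2,3\}$ such that: (D) the classes $\varphi_1,\varphi_2,\varphi_3$ are $\ell^1$-detectable; (C) $H^{n_1}_b(f_1;\mathbb{R})(\varphi_1)\cup H^{n_2}_b(f_2;\mathbb{R})(\varphi_2)=0\in H^{n_1+n_2}_b(\Lambda_1*\Lambda_2;\mathbb{R})$. Then $H^n_b(f;\mathbb{R})\colon H^n_b(\Lambda;\mathbb{R})\to H^n_b(\Gamma;\mathbb{R})$ is not injective. In particular, the group $\Lambda$ is not in $\mathsf{Lex}$.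
   Context: Here $\mathbb{N}$ includes $0$. Bounded cohomology of a discrete group $\Gamma$: $C^n_b(\Gamma;\mathbb{R}):=\ell^\infty(\Gamma^{n+1},\mathbb{R})^\Gamma$ with the simplicial coboundary; $H^*_b(\Gamma;\mathbb{R})$ is its cohomology, contravariantly functorial in group homomorphisms by pullback. The cup product is induced by $(f\cup g)(\gamma_0,\dots,\gamma_{p+q})=f(\gamma_0,\dots,\gamma_p)\,g(\gamma_p,\dots,\gamma_{p+q})$. $\ell^1$-homology $H^{\ell^1}_*(\Gamma;\mathbb{R})$ is the homology of the $\ell^1$-completion of the homogeneous chain complex $C_n(\Gamma;\mathbb{R})=\mathbb{R}\otimes_{\Gamma}\mathbb{R}[\Gamma^{n+1}]$ (with the simplicial boundary operator, and the $\ell^1$-norm with respect to the $\Gamma$-orbits of tuples as basis). Evaluation of bounded cocycles on $\ell^1$-cycles induces a bilinear pairing $\langle\cdot,\cdot\rangle\colon H^n_b(\Gamma;\mathbb{R})\times H^{\ell^1}_n(\Gamma;\mathbb{R})\to\mathbb{R}$. A class $\varphi\in H^n_b(\Gamma;\mathbb{R})$ is $\ell^1$-detectable if there is $\alpha\in H^{\ell^1}_n(\Gamma;\mathbb{R})$ with $\langle\varphi,\alpha\rangle\neq0$. $\mathsf{Lex}$ is the class of all groups $\Lambda$ such that for every group $\Gamma$ and every epimorphism $f\colon\Gamma\to\Lambda$, the induced map $H^*_b(f;\mathbb{R})\colon H^*_b(\Lambda;\mathbb{R})\to H^*_b(\Gamma;\mathbb{R})$ is injective (in all degrees). *)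

(* Defs.v *)
From HB Require Import structures.
From mathcomp Require Import all_boot all_order all_algebra ring lra.
From mathcomp Require Import mathcomp_extra boolp classical_sets functions.
From mathcomp Require Import cardinality fsbigop reals ereal numfun esum.

Set Implicit Arguments.
Unset Strict Implicit.
Unset Printing Implicit Defensive.

Import Order.TTheory GRing.Theory Num.Theory.
Local Open Scope classical_set_scope.
Local Open Scope ring_scope.
Local Open Scope quotient_scope.

(* MathComp quotients a Z-module by a subgroup ([{ideal_quot _}]); here the
   quotient of an R-module by a submodule is given its R-module structure. *)
Section LmodQuotient.
Variables (R : pzRingType) (V : lmodType R) (B : {pred V}).
Hypothesis Bsub : submod_closed B.

Definition submod_pred of submod_closed B : {pred V} := B.
HB.instance Definition _ :=
  GRing.isZmodClosed.Build V (submod_pred Bsub) (GRing.submod_closedB Bsub).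

Definition lmod_quot := {ideal_quot (submod_pred Bsub)}.
HB.instance Definition _ := GRing.Zmodule.on lmod_quot.
HB.instance Definition _ := EqQuotient.on lmod_quot.

Lemma lmod_quotP (x y : V) :
  reflect (\pi_lmod_quot x = \pi_lmod_quot y) (x - y \in B).
Proof.
apply: (iffP idP) => [xyB|/eqmodP].
  by apply/eqmodP; rewrite /= Quotient.equivE.
by rewrite /= Quotient.equivE.
Qed.

Lemma lmod_quot_pi0 (x : V) : reflect (\pi_lmod_quot x = 0) (x \in B).
Proof.
have -> : (0 : lmod_quot) = \pi 0.
  by rewrite (@pi_zeror _ _ _ _ _ {ideal_quot (submod_pred Bsub)}).
by rewrite -[X in X \in B]subr0; exact: lmod_quotP.
Qed.

Lemma lmod_quot_piD (x y : V) : \pi_lmod_quot (x + y) = \pi x + \pi y.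
Proof. by rewrite (@pi_addr _ _ _ _ _ {ideal_quot (submod_pred Bsub)}). Qed.

Lemma lmod_quot_reprP (x : V) : repr (\pi_lmod_quot x) - x \in B.
Proof. by apply/lmod_quotP; rewrite reprK. Qed.

Definition lmod_quot_scale (a : R) (x : lmod_quot) : lmod_quot :=
  \pi_lmod_quot (a *: repr x).

Lemma lmod_quot_piZ a x : lmod_quot_scale a (\pi x) = \pi_lmod_quot (a *: x).
Proof.
apply/lmod_quotP; rewrite -scalerBr.
have [B0 BL] := Bsub.
by rewrite -[_ *: _]addr0 BL// lmod_quot_reprP.
Qed.

Fact lmod_quot_scaleA a b v :
  lmod_quot_scale a (lmod_quot_scale b v) = lmod_quot_scale (a * b) v.
Proof. by rewrite -[v]reprK !lmod_quot_piZ scalerA. Qed.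
Fact lmod_quot_scale1 : left_id 1 lmod_quot_scale.
Proof. by move=> v; rewrite -[v]reprK !lmod_quot_piZ scale1r. Qed.
Fact lmod_quot_scaleDr : right_distributive lmod_quot_scale +%R.
Proof.
move=> a u v; rewrite -[u]reprK -[v]reprK -lmod_quot_piD !lmod_quot_piZ.
by rewrite -lmod_quot_piD scalerDr.
Qed.
Fact lmod_quot_scaleDl v : {morph lmod_quot_scale^~ v : a b / a + b}.
Proof.
by move=> a b; rewrite -[v]reprK !lmod_quot_piZ -lmod_quot_piD scalerDl.
Qed.
HB.instance Definition _ := GRing.Zmodule_isLmodule.Build R lmod_quot
  lmod_quot_scaleA lmod_quot_scale1 lmod_quot_scaleDr lmod_quot_scaleDl.
End LmodQuotient.

(* The free product, presented as words in the letters of [G] and [H] modulo the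
   congruence generated by [1 = empty word] in each factor and by replacing two
   consecutive letters of the same factor by their product. *)
Section FreeProduct.
Local Open Scope group_scope.
Variables G H : groupType.

Inductive freeprod_rel : seq (G + H) -> seq (G + H) -> Prop :=
| freeprod_refl w : freeprod_rel w w
| freeprod_sym w1 w2 : freeprod_rel w1 w2 -> freeprod_rel w2 w1
| freeprod_trans w1 w2 w3 :
    freeprod_rel w1 w2 -> freeprod_rel w2 w3 -> freeprod_rel w1 w3
| freeprod_1l u v : freeprod_rel (u ++ inl 1 :: v) (u ++ v)
| freeprod_1r u v : freeprod_rel (u ++ inr 1 :: v) (u ++ v)
| freeprod_Ml u a b v :
    freeprod_rel (u ++ inl a :: inl b :: v) (u ++ inl (a * b) :: v)
| freeprod_Mr u a b v :
    freeprod_rel (u ++ inr a :: inr b :: v) (u ++ inr (a * b) :: v).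

Lemma freeprod_rel_cat w w' u v :
  freeprod_rel w w' -> freeprod_rel (u ++ w ++ v) (u ++ w' ++ v).
Proof.
elim=> {w w'} [w|w1 w2 _ h|w1 w2 w3 _ h1 _ h2|w1 w2|w1 w2|w1 a b w2|w1 a b w2].
- exact: freeprod_refl.
- exact: freeprod_sym.
- exact: freeprod_trans h1 h2.
- by rewrite -!catA !(catA u) /=; exact: freeprod_1l.
- by rewrite -!catA !(catA u) /=; exact: freeprod_1r.
- by rewrite -!catA !(catA u) /=; exact: freeprod_Ml.
- by rewrite -!catA !(catA u) /=; exact: freeprod_Mr.
Qed.

Definition freeprod_eqb (w w' : seq (G + H)) : bool := `[< freeprod_rel w w' >].

Lemma freeprod_eqb_equiv : equiv_class_of freeprod_eqb.
Proof.
split=> [w|w w'|w2 w1 w3].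
- exact/asboolP/freeprod_refl.
- by apply/asboolP/asboolP; exact: freeprod_sym.
- by move=> /asboolP h1 /asboolP h2; exact/asboolP/(freeprod_trans h1 h2).
Qed.
Canonical freeprod_equiv := EquivRelPack freeprod_eqb_equiv.

Definition freeprod := {eq_quot freeprod_equiv}.
HB.instance Definition _ := EqQuotient.on freeprod.
HB.instance Definition _ := Choice.on freeprod.

Lemma freeprodP (w w' : seq (G + H)) :
  (\pi_freeprod w = \pi_freeprod w') <-> freeprod_rel w w'.
Proof.
by split=> [/eqmodP/asboolP|h]; [|apply/eqmodP/asboolP].
Qed.

Lemma freeprod_reprP w : freeprod_rel (repr (\pi_freeprod w)) w.
Proof. by apply/freeprodP; rewrite reprK. Qed.

Definition freeprod_one : freeprod := \pi_freeprod [::].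
Definition freeprod_mul (x y : freeprod) : freeprod :=
  \pi_freeprod (repr x ++ repr y).
Definition letter_inv (l : G + H) : G + H :=
  match l with inl a => inl a^-1 | inr b => inr b^-1 end.
Definition freeprod_inv (x : freeprod) : freeprod :=
  \pi_freeprod (rev (map letter_inv (repr x))).

Lemma freeprod_mul_pi w w' :
  freeprod_mul (\pi w) (\pi w') = \pi_freeprod (w ++ w').
Proof.
apply/freeprodP; apply: (@freeprod_trans _ (w ++ repr (\pi_freeprod w'))).
  exact: (@freeprod_rel_cat _ _ [::] _ (freeprod_reprP w)).
have := @freeprod_rel_cat _ _ w [::] (freeprod_reprP w').
by rewrite !cats0.
Qed.

Lemma freeprod_relVw w : freeprod_rel (rev (map letter_inv w) ++ w) [::].
Proof.
elim: w => [|l w IHw]; first exact: freeprod_refl.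
rewrite /= rev_cons cat_rcons; apply: freeprod_trans IHw.
case: l => a /=.
- apply: freeprod_trans (freeprod_Ml _ _ _ _) _; rewrite mulVg.
  exact: freeprod_1l.
- apply: freeprod_trans (freeprod_Mr _ _ _ _) _; rewrite mulVg.
  exact: freeprod_1r.
Qed.

Lemma freeprod_relwV w : freeprod_rel (w ++ rev (map letter_inv w)) [::].
Proof.
have iK : involutive letter_inv by case=> a /=; rewrite invgK.
rewrite -{1}[w](mapK iK) -{1}[map letter_inv w]revK map_rev.
exact: freeprod_relVw.
Qed.

Fact freeprod_mulA : associative freeprod_mul.
Proof.
move=> x y z; rewrite -[x]reprK -[y]reprK -[z]reprK.
by rewrite !freeprod_mul_pi catA.
Qed.
Fact freeprod_mul1 : left_id freeprod_one freeprod_mul.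
Proof. by move=> x; rewrite -[x]reprK freeprod_mul_pi. Qed.
Fact freeprod_mulr1 : right_id freeprod_one freeprod_mul.
Proof. by move=> x; rewrite -[x]reprK freeprod_mul_pi cats0. Qed.
Fact freeprod_mulV : left_inverse freeprod_one freeprod_inv freeprod_mul.
Proof.
move=> x; rewrite -[x in freeprod_mul _ x]reprK freeprod_mul_pi.
exact/freeprodP/freeprod_relVw.
Qed.
Fact freeprod_mulrV : right_inverse freeprod_one freeprod_inv freeprod_mul.
Proof.
move=> x; rewrite -[x in freeprod_mul x _]reprK freeprod_mul_pi.
exact/freeprodP/freeprod_relwV.
Qed.
HB.instance Definition _ := isGroup.Build freeprod freeprod_mulA freeprod_mul1
  freeprod_mulr1 freeprod_mulV freeprod_mulrV.

Lemma freeprod_piM w w' :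
  \pi_freeprod (w ++ w') = (\pi w : freeprod) * (\pi w' : freeprod).
Proof. by rewrite -freeprod_mul_pi. Qed.

Definition freeprod_inl (a : G) : freeprod := \pi_freeprod [:: inl a].
Definition freeprod_inr (b : H) : freeprod := \pi_freeprod [:: inr b].

Fact freeprod_inlM : {morph freeprod_inl : a b / a * b}.
Proof.
move=> a b; rewrite -freeprod_piM.
exact/freeprodP/freeprod_sym/(freeprod_Ml [::]).
Qed.
Fact freeprod_inrM : {morph freeprod_inr : a b / a * b}.
Proof.
move=> a b; rewrite -freeprod_piM.
exact/freeprodP/freeprod_sym/(freeprod_Mr [::]).
Qed.
HB.instance Definition _ :=
  isMultiplicative.Build G freeprod freeprod_inl freeprod_inlM.
HB.instance Definition _ :=
  isMultiplicative.Build H freeprod freeprod_inr freeprod_inrM.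
End FreeProduct.

Section FreeProductLift.
Local Open Scope group_scope.
Variables (G H K : groupType).
Variables (f : {multiplicative G -> K}) (g : {multiplicative H -> K}).

Definition letter_lift (l : G + H) : K :=
  match l with inl a => f a | inr b => g b end.

Definition freeprod_lift (x : freeprod G H) : K :=
  \prod_(l <- repr x) letter_lift l.

Lemma gmulf_one (A B : groupType) (h : {multiplicative A -> B}) : h 1 = 1.
Proof. by apply: (mulgI (h 1)); rewrite -gmulfM !mulg1. Qed.

Lemma freeprod_lift_rel w w' : freeprod_rel w w' ->
  \prod_(l <- w) letter_lift l = \prod_(l <- w') letter_lift l.
Proof.
elim=> {w w'} [//|w w' _ -> //|w1 w2 w3 _ -> _ -> //|u v|u v|u a b v|u a b v];
  rewrite !big_cat !big_cons /=.
- by rewrite gmulf_one mul1g.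
- by rewrite gmulf_one mul1g.
- by rewrite gmulfM !mulgA.
- by rewrite gmulfM !mulgA.
Qed.

Lemma freeprod_lift_pi w :
  freeprod_lift (\pi w) = \prod_(l <- w) letter_lift l.
Proof. exact/freeprod_lift_rel/freeprod_reprP. Qed.

Fact freeprod_liftM : {morph freeprod_lift : x y / x * y}.
Proof.
move=> x y; rewrite -[x]reprK -[y]reprK -freeprod_piM !freeprod_lift_pi.
exact: big_cat.
Qed.
HB.instance Definition _ :=
  isMultiplicative.Build (freeprod G H) K freeprod_lift freeprod_liftM.

Lemma freeprod_lift_inl a : freeprod_lift (freeprod_inl H a) = f a.
Proof. by rewrite freeprod_lift_pi big_seq1. Qed.
Lemma freeprod_lift_inr b : freeprod_lift (freeprod_inr G b) = g b.
Proof. by rewrite freeprod_lift_pi big_seq1. Qed.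

Lemma freeprod_lift_uniq (h : {multiplicative freeprod G H -> K}) :
  (forall a, h (freeprod_inl H a) = f a) ->
  (forall b, h (freeprod_inr G b) = g b) -> h =1 freeprod_lift.
Proof.
move=> hl hr x; rewrite -[x]reprK; elim: (repr x) => [|l w IHw].
  by rewrite freeprod_lift_pi big_nil; exact: gmulf_one.
rewrite -cat1s freeprod_piM !gmulfM IHw.
by case: l => c; rewrite ?hl ?hr /= !freeprod_lift_pi big_seq1.
Qed.
End FreeProductLift.

Section Projections.
Local Open Scope group_scope.
Variables (L1 L2 L3 : groupType).
Definition freeprod_proj1 : {multiplicative freeprod L1 L2 -> L1} :=
  freeprod_lift (@idfun L1) (@one_fun L2 L1).
Definition freeprod_proj2 : {multiplicative freeprod L1 L2 -> L2} :=
  freeprod_lift (@one_fun L1 L2) (@idfun L2).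

Definition freeprod_to_prod (x : freeprod L1 L2 * L3) : (L1 * L2) * L3 :=
  ((freeprod_proj1 x.1, freeprod_proj2 x.1), x.2).

Fact freeprod_to_prodM : {morph freeprod_to_prod : x y / x * y}.
Proof. by move=> x y; rewrite /freeprod_to_prod !gmulfM. Qed.
HB.instance Definition _ := isMultiplicative.Build (freeprod L1 L2 * L3)%type
  ((L1 * L2) * L3)%type freeprod_to_prod freeprod_to_prodM.
End Projections.
Arguments freeprod_to_prod : clear implicits.

(* Homogeneous simplices: (n+1)-tuples of elements of [G]. *)
Notation simplex G n := ('I_n.+1 -> G).
(* [R^o] is [R] as a module over itself, so that cochains form an R-module. *)
Notation cochain R G n := (('I_n.+1 -> G) -> R^o).

Section Simplices.
Variable G : groupType.

Definition face n (i : 'I_n.+2) (t : simplex G n.+1) : simplex G n :=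
  fun j => t (lift i j).

Definition sact n (g : G) (t : simplex G n) : simplex G n :=
  fun j => (g * t j)%g.

Lemma face_sact n (i : 'I_n.+2) g t : face i (sact g t) = sact g (face i t).
Proof. by []. Qed.
End Simplices.

Section BoundedCohomology.
Variables (R : realType) (G : groupType).

Definition coboundary n (f : cochain R G n) : cochain R G n.+1 :=
  fun t => \sum_(i < n.+2) (-1) ^+ i * f (face i t).

Definition bcochain n (f : cochain R G n) : Prop :=
  (exists M : R, forall t, `|f t| <= M) /\ (forall g t, f (sact g t) = f t).

(* The complex starts in degree 0, where only 0 is a coboundary. *)
Definition is_bcoboundary n : cochain R G n -> Prop :=
  match n with
  | 0 => fun f => f = 0
  | m.+1 => fun f => exists2 g : cochain R G m, bcochain g & f = coboundary g
  end.

Lemma coboundaryL n (a : R) (f g : cochain R G n) :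
  coboundary (a *: f + g) = a *: coboundary f + coboundary g.
Proof.
apply/funext => t; rewrite /coboundary !fctE scaler_sumr -big_split /=.
by apply: eq_bigr => i _; rewrite mulrDr /GRing.scale /= mulrCA.
Qed.

Lemma coboundary0 n : coboundary (0 : cochain R G n) = 0.
Proof. by apply/funext => t; apply: big1 => i _; rewrite mulr0. Qed.

Lemma bcochain0 n : bcochain (0 : cochain R G n).
Proof. by split=> //; exists 0 => t; rewrite normr0. Qed.

Lemma bcochainL n (a : R) (f g : cochain R G n) :
  bcochain f -> bcochain g -> bcochain (a *: f + g).
Proof.
move=> [[M fM] fG] [[N gN] gG]; split; last first.
  by move=> x t; rewrite !fctE fG gG.
exists (`|a| * M + N) => t; rewrite !fctE (le_trans (ler_normD _ _))// lerD//.
by rewrite normrM ler_wpM2l.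
Qed.

Lemma is_bcoboundary0 n : is_bcoboundary (0 : cochain R G n).
Proof.
case: n => [//|n]; exists 0; first exact: bcochain0.
by rewrite coboundary0.
Qed.

Lemma is_bcoboundaryL n (a : R) (f g : cochain R G n) :
  is_bcoboundary f -> is_bcoboundary g -> is_bcoboundary (a *: f + g).
Proof.
case: n f g => [|n] f g /=; first by move=> -> ->; rewrite scaler0 addr0.
move=> [f' bf ->] [g' bg ->]; exists (a *: f' + g'); first exact: bcochainL.
by rewrite coboundaryL.
Qed.

Definition bcocycle n : {pred cochain R G n} :=
  fun f => `[< bcochain f /\ coboundary f = 0 >].

Fact bcocycle_submod n : GRing.subsemimod_closed (@bcocycle n).
Proof.
have L (a : R) f g : f \in @bcocycle n -> g \in @bcocycle n ->
    a *: f + g \in @bcocycle n.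
  move=> /asboolP[bf df] /asboolP[bg dg]; apply/asboolP; split.
    exact: bcochainL.
  by rewrite coboundaryL df dg scaler0 addr0.
have Z0 : 0 \in @bcocycle n.
  by apply/asboolP; split; [exact: bcochain0|exact: coboundary0].
split; first split => //.
  by move=> f g Zf Zg; rewrite -[f]scale1r L.
by move=> a f Zf; rewrite -[_ *: _]addr0 L.
Qed.
HB.instance Definition _ n :=
  GRing.isSubmodClosed.Build R (cochain R G n) (@bcocycle n) (@bcocycle_submod n).

Record bcocycleType n :=
  BCocycle { bcocycle_val : cochain R G n; _ : bcocycle_val \in @bcocycle n }.
HB.instance Definition _ n := [isSub for @bcocycle_val n].
HB.instance Definition _ n := [Choice of bcocycleType n by <:].
HB.instance Definition _ n := [SubChoice_isSubZmodule of bcocycleType n by <:].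
HB.instance Definition _ n := [SubZmodule_isSubLmodule of bcocycleType n by <:].

Definition bcobounding n : {pred bcocycleType n} :=
  fun z => `[< is_bcoboundary (val z) >].

Fact bcobounding_submod n : submod_closed (@bcobounding n).
Proof.
split; first by apply/asboolP; exact: is_bcoboundary0.
by move=> a y z /asboolP By /asboolP Bz; apply/asboolP; exact: is_bcoboundaryL.
Qed.

Definition bcohomology n := lmod_quot (@bcobounding_submod n).
End BoundedCohomology.

Section Functoriality.
Variables (R : realType) (G H : groupType) (h : {multiplicative G -> H}).

Definition pullback_cochain n (f : cochain R H n) : cochain R G n :=
  fun t => f (h \o t).

Lemma pullback_coboundary n (f : cochain R H n) :
  pullback_cochain (coboundary f) = coboundary (pullback_cochain f).
Proof. by []. Qed.

Lemma bcochain_pullback n (f : cochain R H n) :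
  bcochain f -> bcochain (pullback_cochain f).
Proof.
move=> [[M fM] fG]; split; first by exists M => t; exact: fM.
move=> g t; rewrite /pullback_cochain -[RHS](fG (h g)); congr f.
by apply/funext => j; rewrite /sact /= gmulfM.
Qed.

Lemma is_bcoboundary_pullback n (f : cochain R H n) :
  is_bcoboundary f -> is_bcoboundary (pullback_cochain f).
Proof.
case: n f => [|n] f /=; first by move=> ->.
by move=> [g bg ->]; exists (pullback_cochain g); first exact: bcochain_pullback.
Qed.

Fact pullback_bcocycle n (z : bcocycleType R H n) :
  pullback_cochain (val z) \in @bcocycle R G n.
Proof.
have /asboolP[bz dz] := valP z; apply/asboolP; split.
  exact: bcochain_pullback.
by rewrite -pullback_coboundary dz.
Qed.

Definition bcocycle_map n (z : bcocycleType R H n) : bcocycleType R G n :=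
  BCocycle (pullback_bcocycle z).

(* Defined on a representative; see [bcohomology_map_pi]. *)
Definition bcohomology_map n (x : bcohomology R H n) : bcohomology R G n :=
  \pi_(bcohomology R G n) (bcocycle_map (repr x)).

Lemma bcohomology_map_pi n (z : bcocycleType R H n) :
  bcohomology_map (\pi_(bcohomology R H n) z) =
  \pi_(bcohomology R G n) (bcocycle_map z).
Proof.
apply/lmod_quotP/asboolP.
have /asboolP := lmod_quot_reprP (@bcobounding_submod R H n) z.
exact: is_bcoboundary_pullback.
Qed.

Fact bcohomology_map_linear n : linear (@bcohomology_map n).
Proof.
move=> a x y; rewrite -[x]reprK -[y]reprK.
rewrite -[X in bcohomology_map (X + _)]/(lmod_quot_scale _ _).
rewrite lmod_quot_piZ -lmod_quot_piD !bcohomology_map_pi.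
rewrite -[X in _ = X + _]/(lmod_quot_scale _ _) lmod_quot_piZ -lmod_quot_piD.
by congr \pi; exact: val_inj.
Qed.
HB.instance Definition _ n := GRing.isLinear.Build R (bcohomology R H n)
  (bcohomology R G n) _ (@bcohomology_map n) (@bcohomology_map_linear n).
End Functoriality.

Section CupProduct.
Variables (R : realType) (G : groupType).

(* [front_face p t] is (t_0, ..., t_p) and [back_face p q t] is
   (t_p, ..., t_{p+q}). They are only meant for [n = p + q], in which case
   [inord] does not truncate; the target degree [n] is left free to avoid
   transport along equalities such as p + q.+1 = (p + q).+1. *)
Definition front_face p n (t : simplex G n) : simplex G p := fun j => t (inord j).
Definition back_face p q n (t : simplex G n) : simplex G q :=
  fun j => t (inord (p + j)).
Arguments front_face p [n] t _.
Arguments back_face p q [n] t _.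

Definition cup_cochain p q n (f : cochain R G p) (g : cochain R G q) :
    cochain R G n :=
  fun t => f (front_face p t) * g (back_face p q t).
Arguments cup_cochain [p q] n f g t.

Lemma cup_cochainDl p q n (a : R) (f1 f2 : cochain R G p) (g : cochain R G q) :
  cup_cochain n (a *: f1 + f2) g = a *: cup_cochain n f1 g + cup_cochain n f2 g.
Proof. by apply/funext => t; rewrite /cup_cochain !fctE mulrDl scalerAl. Qed.

Lemma cup_cochainDr p q n (a : R) (f : cochain R G p) (g1 g2 : cochain R G q) :
  cup_cochain n f (a *: g1 + g2) = a *: cup_cochain n f g1 + cup_cochain n f g2.
Proof. by apply/funext => t; rewrite /cup_cochain !fctE mulrDr -scalerAr. Qed.

Lemma bcochain_cup p q n (f : cochain R G p) (g : cochain R G q) :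
  bcochain f -> bcochain g -> bcochain (cup_cochain n f g).
Proof.
move=> [[M fM] fG] [[N gN] gG]; split.
  by exists (M * N) => t; rewrite normrM ler_pM.
move=> x t; rewrite /cup_cochain.
rewrite -[front_face p _]/(sact x (front_face p t)).
by rewrite -[back_face p q _]/(sact x (back_face p q t)) fG gG.
Qed.

Lemma coboundary_cup p q n (f : cochain R G p) (g : cochain R G q) :
  n = (p + q)%N ->
  coboundary (cup_cochain n f g) =
  cup_cochain n.+1 (coboundary f) g + (-1) ^+ p *: cup_cochain n.+1 f (coboundary g).
Proof.
move=> npq; apply/funext => t; rewrite /cup_cochain /coboundary !fctE.
pose T k := t (inord k).
have bumpE m (i k : nat) : (k < m)%N -> (bump i k < m.+1)%N.
  by move=> km; rewrite /bump ltnS; case: (i <= k)%N; [|exact: ltnW].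
have liftE (i : 'I_n.+2) k : (k < n.+1)%N -> t (lift i (inord k)) = T (bump i k).
  move=> kn; congr t; apply: val_inj => /=.
  by rewrite !inordK// bumpE.
pose F i := f (fun j : 'I_p.+1 => T (bump i j)).
pose E i := g (fun j : 'I_q.+1 => T (bump i (p + j)%N)).
pose g1 := g (fun j : 'I_q.+1 => T (p.+1 + j)%N).
pose f0 := f (fun j : 'I_p.+1 => T j).
rewrite (eq_bigr (fun i : 'I_n.+2 => (-1) ^+ i * (F i * E i))); last first.
  move=> i _; congr (_ * (f _ * g _)); apply/funext => j;
    rewrite /front_face /back_face /face liftE//.
    by rewrite (leq_trans (ltn_ord j))// npq ltnS leq_addr.
  by rewrite npq ltnS leq_add2l -ltnS.
rewrite [in RHS](eq_bigr (fun i : 'I_p.+2 => (-1) ^+ i * F i)); last by [].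
rewrite -[g (back_face p.+1 q t)]/g1 -[f (front_face p t)]/f0.
rewrite -(big_mkord xpredT (fun i => (-1) ^+ i * (F i * E i))).
rewrite (@big_cat_nat _ _ _ p.+1)//=; last by rewrite npq !ltnS leqW// leq_addr.
rewrite big_mkord (eq_bigr (fun i : 'I_p.+1 => (-1) ^+ i * F i * g1)); last first.
  move=> i _; rewrite mulrA; congr (_ * g _); apply/funext => j.
  have ip : (i <= p)%N by rewrite -ltnS.
  by rewrite /bump (leq_trans ip) ?leq_addr.
rewrite -mulr_suml [in RHS]big_ord_recr /= mulrDl -addrA; congr (_ + _).
have -> : F p.+1 = f0.
  by congr f; apply/funext => j; rewrite /bump leqNgt ltn_ord.
rewrite big_ord_recl /= expr0 mul1r.
have -> : g (face ord0 (back_face p q.+1 t)) = g1.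
  congr g; apply/funext => j; rewrite /back_face /face /T /=; congr (t (inord _)).
  by rewrite /bump leq0n addnA addn1.
rewrite mulrDr scalerDr addrA [X in _ = X + _](_ : _ = 0); last first.
  rewrite exprS mulN1r !mulNr -mulrA; exact: addNr.
rewrite add0r -{1}[p.+1]add0n big_addn /GRing.scale /=.
have -> : (n.+2 - p.+1 = q.+1)%N by rewrite npq subSS -addnS addKn.
rewrite big_mkord mulrA mulr_sumr; apply: eq_bigr => k _.
have -> : F (k + p.+1)%N = f0.
  congr f; apply/funext => j; rewrite /bump leqNgt.
  by rewrite (leq_trans (ltn_ord j) (leq_addl _ _)).
have -> : E (k + p.+1)%N = g (face (lift ord0 k) (back_face p q.+1 t)).
  congr g; apply/funext => j; rewrite /back_face /face /T /=; congr (t (inord _)).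
  have -> : (k + p.+1 = p + k.+1)%N by rewrite addnC addSnnS.
  rewrite /bump leq0n add1n leq_add2l; exact: addnCA.
by rewrite /= /bump /= add1n addnS -addSn exprD; ring.
Qed.

Lemma cup_cochain0l p q n (g : cochain R G q) :
  cup_cochain n (0 : cochain R G p) g = 0.
Proof. by apply/funext => t; exact: mul0r. Qed.
Lemma cup_cochain0r p q n (f : cochain R G p) :
  cup_cochain n f (0 : cochain R G q) = 0.
Proof. by apply/funext => t; exact: mulr0. Qed.

Lemma is_bcoboundary_cupl p q (f : cochain R G p) (g : cochain R G q) :
  is_bcoboundary f -> g \in @bcocycle R G q ->
  is_bcoboundary (cup_cochain (p + q) f g).
Proof.
move=> + /asboolP[bg dg]; case: p f => [|p] f /=.
  by move=> ->; rewrite cup_cochain0l; exact: is_bcoboundary0.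
move=> [f' bf ->]; exists (cup_cochain (p + q) f' g); first exact: bcochain_cup.
by rewrite coboundary_cup// dg cup_cochain0r scaler0 addr0.
Qed.

Lemma is_bcoboundary_cupr p q n (f : cochain R G p) (g : cochain R G q) :
  n = (p + q)%N -> f \in @bcocycle R G p -> is_bcoboundary g ->
  is_bcoboundary (cup_cochain n f g).
Proof.
move=> + /asboolP[bf df]; case: q g => [|q] g /= npq.
  by move=> ->; rewrite cup_cochain0r; exact: is_bcoboundary0.
move=> [g' bg ->]; move: npq; rewrite addnS => ->.
exists ((-1) ^+ p *: cup_cochain (p + q) f g').
  by rewrite -[_ *: _]addr0; apply: bcochainL; [exact: bcochain_cup|exact: bcochain0].
rewrite -[_ *: _]addr0 coboundaryL coboundary0 addr0 coboundary_cup//.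
by rewrite df cup_cochain0l add0r scalerA -expr2 sqrr_sign scale1r.
Qed.

Fact cup_bcocycle_subproof p q (y : bcocycleType R G p) (z : bcocycleType R G q) :
  cup_cochain (p + q) (val y) (val z) \in @bcocycle R G (p + q).
Proof.
have /asboolP[by_ dy] := valP y; have /asboolP[bz dz] := valP z.
apply/asboolP; split; first exact: bcochain_cup.
by rewrite coboundary_cup// dy dz cup_cochain0l cup_cochain0r scaler0 addr0.
Qed.

Definition cup_bcocycle p q (y : bcocycleType R G p) (z : bcocycleType R G q) :
    bcocycleType R G (p + q) :=
  BCocycle (cup_bcocycle_subproof y z).

(* Defined on representatives; see [cup_pi]. *)
Definition cup p q (x : bcohomology R G p) (y : bcohomology R G q) :
    bcohomology R G (p + q) :=
  \pi_(bcohomology R G (p + q)) (cup_bcocycle (repr x) (repr y)).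

Lemma cup_pi p q (y : bcocycleType R G p) (z : bcocycleType R G q) :
  cup (\pi_(bcohomology R G p) y) (\pi_(bcohomology R G q) z) =
  \pi_(bcohomology R G (p + q)) (cup_bcocycle y z).
Proof.
rewrite /cup; set y' := repr (_ y); set z' := repr (_ z).
have /asboolP By := lmod_quot_reprP (@bcobounding_submod R G p) y.
have /asboolP Bz := lmod_quot_reprP (@bcobounding_submod R G q) z.
transitivity (\pi_(bcohomology R G (p + q)) (cup_bcocycle y z')).
  apply/lmod_quotP/asboolP.
  have := is_bcoboundary_cupl By (valP z'); congr is_bcoboundary.
  apply/funext => t; exact: mulrBl.
apply/lmod_quotP/asboolP.
have := is_bcoboundary_cupr erefl (valP y) Bz; congr is_bcoboundary.
apply/funext => t; exact: mulrBr.
Qed.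
End CupProduct.

(* [ell1 D f] : [f] is absolutely summable over [D] (which may be uncountable);
   [ell1_sum D f] is then its sum, computed as the sum of the positive part minus
   the sum of the negative part. *)
Definition ell1 (R : realType) (T : choiceType) (D : set T) (f : T -> R) : Prop :=
  summable D (EFin \o f).

Definition ell1_sum (R : realType) (T : choiceType) (D : set T) (f : T -> R) : R :=
  fine (\esum_(x in D) (f^\+ x)%:E) - fine (\esum_(x in D) (f^\- x)%:E).

Section Ell1Sum.
Variables (R : realType) (T : choiceType).
Implicit Types (D : set T) (f g u v : T -> R).

Let S D u := fine (\esum_(x in D) (u x)%:E).

Lemma ell1_le D f g :
  ell1 D f -> (forall x, D x -> `|g x| <= `|f x|) -> ell1 D g.
Proof.
by move=> + gf; apply: le_lt_trans; apply: le_esum => x Dx; rewrite lee_fin gf.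
Qed.

Lemma ell1_sub D D' f : D `<=` D' -> ell1 D' f -> ell1 D f.
Proof.
move=> DD'; apply: le_lt_trans; apply: ub_ereal_sup => _ [X [finX XD] <-].
by apply: ereal_sup_ubound; exists X => //; split=> // x /XD/DD'.
Qed.

Lemma ell1D D f g : ell1 D f -> ell1 D g -> ell1 D (f \+ g).
Proof. exact: summableD. Qed.

Lemma ell1_fin D u : (forall x, D x -> 0 <= u x) -> ell1 D u ->
  (\esum_(x in D) (u x)%:E)%E \is a fin_num.
Proof.
move=> u0; rewrite /ell1 summableE (eq_esum (b := fun x => (u x)%:E))//.
by move=> x Dx /=; rewrite ger0_norm// u0.
Qed.

Lemma ell1_finP D u : (forall x, D x -> 0 <= u x) ->
  (\esum_(x in D) (u x)%:E < +oo)%E -> ell1 D u.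
Proof.
move=> u0; apply: le_lt_trans; apply: le_esum => x Dx /=.
by rewrite ger0_norm// u0.
Qed.

Let SD D u v : (forall x, D x -> 0 <= u x) -> (forall x, D x -> 0 <= v x) ->
  ell1 D u -> ell1 D v -> S D (u \+ v) = S D u + S D v.
Proof.
move=> u0 v0 lu lv; rewrite /S -fineD ?ell1_fin//.
by rewrite -esumD// => x Dx; rewrite lee_fin (u0, v0).
Qed.

Let Sext D u v : (forall x, D x -> u x = v x) -> S D u = S D v.
Proof. by move=> uv; rewrite /S; congr fine; apply: eq_esum => x /uv ->. Qed.

Lemma ell1_pos D f : ell1 D f -> ell1 D f^\+.
Proof.
move=> lf; apply: (ell1_le lf) => x _; rewrite ger0_norm ?funrpos_ge0//.
by rewrite /funrpos ge_max ler_norm normr_ge0.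
Qed.

Lemma ell1_neg D f : ell1 D f -> ell1 D f^\-.
Proof.
move=> lf; apply: (ell1_le lf) => x _; rewrite ger0_norm ?funrneg_ge0//.
by rewrite /funrneg ge_max -normrN ler_norm normr_ge0.
Qed.

Let posneg f x : f x = f^\+ x - f^\- x.
Proof.
rewrite /funrpos /funrneg; have [fx|fx] := leP 0 (f x).
  by rewrite max_r ?subr0// oppr_le0.
by rewrite max_l ?sub0r ?opprK// oppr_ge0 ltW. Qed.

Lemma ell1_sumB D f u v :
  (forall x, D x -> 0 <= u x) -> (forall x, D x -> 0 <= v x) ->
  ell1 D u -> ell1 D v -> (forall x, D x -> f x = u x - v x) ->
  ell1_sum D f = S D u - S D v.
Proof.
move=> u0 v0 lu lv fE.
have lf : ell1 D f.
  apply: (ell1_le (ell1D lu lv)) => x Dx; rewrite fE//= [leRHS]ger0_norm ?addr_ge0 ?u0 ?v0//.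
  by rewrite (le_trans (ler_normB _ _))// !ger0_norm ?u0 ?v0.
suff : S D f^\+ + S D v = S D u + S D f^\-.
  by rewrite /ell1_sum -/(S _ _) -/(S _ _); lra.
rewrite -!SD//; [|exact: ell1_neg|exact: ell1_pos].
by apply: Sext => x Dx /=; have := posneg f x; rewrite fE//; lra.
Qed.

Lemma eq_ell1_sum D f g : (forall x, D x -> f x = g x) ->
  ell1_sum D f = ell1_sum D g.
Proof.
move=> fg; rewrite /ell1_sum; congr (fine _ - fine _); apply: eq_esum => x Dx.
  by rewrite /funrpos fg.
by rewrite /funrneg fg.
Qed.

Lemma ell1_sum0 D : ell1_sum D (fun=> 0 : R) = 0.
Proof.
rewrite /ell1_sum !esum1 ?subrr// => x _; first by rewrite /funrneg oppr0 maxxx.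
by rewrite /funrpos maxxx.
Qed.

Lemma ell1_sum_indic D a :
  ell1_sum D (fun x => (x == a)%:R : R) = `[< D a >]%:R.
Proof.
have E B : (\esum_(x in B) ((x == a)%:R : R)%:E)%E = ((`[< B a >]%:R : R)%:E)%E.
  rewrite (esumID [set a]); last by move=> x _; rewrite lee_fin.
  rewrite [X in (_ + X)%E]esum1 ?adde0; last first.
    by move=> x [_ /= /eqP/negbTE ->].
  have [Ba|nBa] := pselect (B a).
    rewrite (_ : B `&` [set a] = [set a]) ?esum_set1 ?eqxx ?asboolT//.
    by apply/seteqP; split => x; [case|move=> /= ->].
  rewrite asboolF// esum1// => x [Bx /= xa]; by case: nBa; rewrite -xa.
have l1 B : ell1 B (fun x => (x == a)%:R : R).
  by apply: ell1_finP; rewrite ?E ?ltry.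
rewrite (@ell1_sumB D _ (fun x => (x == a)%:R) (fun=> 0))//.
- by rewrite /S E esum1// subr0.
- by apply: ell1_finP => //; rewrite esum1.
- by move=> x _; rewrite subr0.
Qed.

Lemma ell1_0 D : ell1 D (fun=> 0 : R).
Proof. by apply: ell1_finP => //; rewrite esum1. Qed.

Lemma ell1_sumD D f g : ell1 D f -> ell1 D g ->
  ell1_sum D (f \+ g) = ell1_sum D f + ell1_sum D g.
Proof.
move=> lf lg.
rewrite (@ell1_sumB D _ (f^\+ \+ g^\+) (f^\- \+ g^\-)).
- rewrite !SD//; [|exact: ell1_neg|exact: ell1_neg|exact: ell1_pos|exact: ell1_pos].
  by rewrite /ell1_sum -!/(S _ _); lra.
- by move=> x _ /=; rewrite addr_ge0.
- by move=> x _ /=; rewrite addr_ge0.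
- by apply: ell1D; exact: ell1_pos.
- by apply: ell1D; exact: ell1_neg.
- by move=> x _ /=; rewrite (posneg f) (posneg g); lra.
Qed.

Lemma ell1_sumN D f : ell1 D f -> ell1_sum D (\- f) = - ell1_sum D f.
Proof.
move=> lf; rewrite (@ell1_sumB D _ f^\- f^\+)//.
- by rewrite /ell1_sum -!/(S _ _) opprB.
- exact: ell1_neg.
- exact: ell1_pos.
- by move=> x _ /=; rewrite {1}(posneg f) opprB.
Qed.

Let le_esumZ D u a : 0 < a -> (forall x, D x -> 0 <= u x) ->
  (\esum_(x in D) (a * u x)%:E <= a%:E * \esum_(x in D) (u x)%:E)%E.
Proof.
move=> a0 u0; apply: ge_ereal_sup => _ [X [finX XD] <-].
rewrite -lee_pdivrMl//; apply: ereal_sup_ubound; exists X => //.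
rewrite !fsumEFin// -EFinM; congr EFin.
rewrite !fsbig_finite//= mulr_sumr; apply: eq_bigr => x _.
by rewrite mulKf// gt_eqF.
Qed.

Lemma ge0_ell1_sumZ D u a : 0 < a -> (forall x, D x -> 0 <= u x) ->
  S D (a \*o u) = a * S D u.
Proof.
move=> a0 u0; rewrite /S.
have -> : (\esum_(x in D) (a * u x)%:E = a%:E * \esum_(x in D) (u x)%:E)%E.
  apply/eqP; rewrite eq_le le_esumZ//= -lee_pdivlMl//.
  have -> : (\esum_(x in D) (u x)%:E = \esum_(x in D) (a^-1 * (a * u x))%:E)%E.
    by apply: eq_esum => x _; rewrite mulKf// gt_eqF.
  apply: le_esumZ => [|x Dx]; first by rewrite invr_gt0.
  by rewrite mulr_ge0 ?(ltW a0)// u0.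
have : (0 <= \esum_(x in D) (u x)%:E)%E by apply: esum_ge0 => x /u0.
case: (\esum_(x in D) (u x)%:E)%E => [r _|_|//]; first by rewrite -EFinM.
by rewrite gt0_muley ?lte_fin//= mulr0.
Qed.

Lemma ell1Z D f a : ell1 D f -> ell1 D (a \*o f).
Proof.
have [->|a0] := eqVneq a 0.
  by move=> _; apply: (ell1_le (ell1_0 D)) => x _ /=; rewrite mul0r.
move=> lf; suff : ell1 D (`|a| \*o (fun x => `|f x|)).
  by move/ell1_le; apply => x _ /=; rewrite !normrM !normr_id.
apply: ell1_finP; first by move=> x _ /=; rewrite mulr_ge0.
apply: (@le_lt_trans _ _ (`|a|%:E * \esum_(x in D) `|f x|%:E)%E).
  by apply: le_esumZ; rewrite ?normr_gt0.
by rewrite lte_mul_pinfty.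
Qed.

Lemma ell1_sumZ D f a : ell1 D f -> ell1_sum D (a \*o f) = a * ell1_sum D f.
Proof.
have pos b : 0 < b -> ell1 D f -> ell1_sum D (b \*o f) = b * ell1_sum D f.
  move=> b0 lf; rewrite (@ell1_sumB D _ (b \*o f^\+) (b \*o f^\-)).
  - by rewrite !ge0_ell1_sumZ// /ell1_sum mulrBr.
  - by move=> x _ /=; rewrite mulr_ge0// ltW.
  - by move=> x _ /=; rewrite mulr_ge0// ltW.
  - exact/ell1Z/ell1_pos.
  - exact/ell1Z/ell1_neg.
  - by move=> x _ /=; rewrite {1}(posneg f) mulrBr.
move=> lf; have [a0|a0|->] := ltgtP a 0; [|exact: pos|]; last first.
  rewrite mul0r -[RHS](ell1_sum0 D); apply: eq_ell1_sum => x _ /=.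
  exact: mul0r.
rewrite (@eq_ell1_sum _ _ (\- ((- a) \*o f))); last first.
  by move=> x _ /=; rewrite mulNr opprK.
by rewrite ell1_sumN ?pos ?oppr_gt0//; [rewrite mulNr opprK|exact: ell1Z].
Qed.

Lemma ell1_big (I : Type) (r : seq I) (P : pred I) (F : I -> T -> R) D :
  (forall i, ell1 D (F i)) -> ell1 D (fun x => \sum_(i <- r | P i) F i x).
Proof.
move=> lF; elim: r => [|i r IHr].
  by under eq_fun do rewrite big_nil; exact: ell1_0.
under eq_fun do rewrite big_cons.
by case: (P i) => //; exact: ell1D (lF i) IHr.
Qed.

Lemma ell1_sum_big (I : Type) (r : seq I) (P : pred I) (F : I -> T -> R) D :
  (forall i, ell1 D (F i)) ->
  ell1_sum D (fun x => \sum_(i <- r | P i) F i x) =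
  \sum_(i <- r | P i) ell1_sum D (F i).
Proof.
move=> lF; elim: r => [|i r IHr].
  by rewrite big_nil; under eq_fun do rewrite big_nil; exact: ell1_sum0.
rewrite big_cons; under eq_fun do rewrite big_cons.
by case: (P i) => //; rewrite -IHr; apply: ell1_sumD => //; exact: ell1_big.
Qed.
End Ell1Sum.

Section Ell1Fiber.
Variables (R : realType) (T T' : choiceType) (p : T -> T').
Implicit Types (f u : T -> R).

Let esum_fiber u : (forall x, 0 <= u x) ->
  (\esum_(y in [set: T']) \esum_(x in [set x | p x = y]) (u x)%:E =
   \esum_(x in [set: T]) (u x)%:E)%E.
Proof.
move=> u0; rewrite esum_esum//; last by move=> *; rewrite lee_fin.
apply: (@reindex_esum _ _ _ _ _ (fun x => (p x, x))); split=> //.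
- by move=> x y _ _ [].
- by move=> [y x] /= [_ <-]; exists x.
Qed.

Let S (A : choiceType) (D : set A) (v : A -> R) := fine (\esum_(x in D) (v x)%:E).

Let fiber_pos u : (forall x, 0 <= u x) -> ell1 [set: T] u ->
  let v y := S [set x | p x = y] u in
  [/\ forall y, 0 <= v y, ell1 [set: T'] v & S [set: T'] v = S [set: T] u].
Proof.
move=> u0 lu v.
have v0 y : 0 <= v y by rewrite fine_ge0// esum_ge0// => x _; rewrite lee_fin.
have vE : (\esum_(y in [set: T']) (v y)%:E = \esum_(x in [set: T]) (u x)%:E)%E.
  rewrite -esum_fiber//; apply: eq_esum => y _; rewrite fineK// ell1_fin//.
  exact: ell1_sub lu.
split=> //; last by rewrite /S vE.
apply: ell1_finP => //; rewrite vE ltey_eq.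
by rewrite ell1_fin.
Qed.

Lemma ell1_fiber f : ell1 [set: T] f ->
  ell1 [set: T'] (fun y => ell1_sum [set x | p x = y] f).
Proof.
move=> lf.
have [p0 lp _] := fiber_pos (funrpos_ge0 f) (ell1_pos lf).
have [n0 ln _] := fiber_pos (funrneg_ge0 f) (ell1_neg lf).
apply: (ell1_le (ell1D lp ln)) => y _; rewrite /= [leRHS]ger0_norm ?addr_ge0//.
by rewrite (le_trans (ler_normB _ _))// !ger0_norm ?p0 ?n0.
Qed.

Lemma ell1_sum_fiber f : ell1 [set: T] f ->
  ell1_sum [set: T'] (fun y => ell1_sum [set x | p x = y] f) =
  ell1_sum [set: T] f.
Proof.
move=> lf.
have [p0 lp pE] := fiber_pos (funrpos_ge0 f) (ell1_pos lf).
have [n0 ln nE] := fiber_pos (funrneg_ge0 f) (ell1_neg lf).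
rewrite (ell1_sumB (fun y _ => p0 y) (fun y _ => n0 y) lp ln)//.
by rewrite -/(S _ _) -/(S _ _) pE nE.
Qed.
End Ell1Fiber.

(* [R (x)_G R[G^{n+1}]] is the free R-module on the orbits of the diagonal action
   of [G] on (n+1)-tuples. *)
Section Orbits.
Variable G : groupType.

Definition orbit_eqb n (t t' : simplex G n) : bool :=
  `[< exists g, t' = sact g t >].

Lemma orbit_eqb_equiv n : equiv_class_of (@orbit_eqb n).
Proof.
split=> [t|t t'|t2 t1 t3].
- by apply/asboolP; exists 1%g; apply/funext => j; rewrite /sact mul1g.
- apply/asboolP/asboolP => -[g ->]; exists (g^-1)%g; apply/funext => j;
    by rewrite /sact mulKg.
- move=> /asboolP[g ->] /asboolP[k ->]; apply/asboolP; exists (k * g)%g.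
  by apply/funext => j; rewrite /sact mulgA.
Qed.
Canonical simplex_orbit_equiv n := EquivRelPack (@orbit_eqb_equiv n).

Definition simplex_orbit n := {eq_quot (simplex_orbit_equiv n)}.
HB.instance Definition _ n := EqQuotient.on (simplex_orbit n).
HB.instance Definition _ n := Choice.on (simplex_orbit n).

Lemma simplex_orbitP n (t t' : simplex G n) :
  \pi_(simplex_orbit n) t = \pi_(simplex_orbit n) t' <-> exists g, t' = sact g t.
Proof. by split=> [/eqmodP/asboolP|h]; [|apply/eqmodP/asboolP]. Qed.

Definition simplex_orbit_face n (i : 'I_n.+2) (o : simplex_orbit n.+1) :
    simplex_orbit n :=
  \pi_(simplex_orbit n) (face i (repr o)).

Lemma simplex_orbit_face_pi n (i : 'I_n.+2) (t : simplex G n.+1) :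
  simplex_orbit_face i (\pi_(simplex_orbit n.+1) t) = \pi_(simplex_orbit n) (face i t).
Proof.
have /simplex_orbitP[g tE] :
    \pi_(simplex_orbit n.+1) (repr (\pi_(simplex_orbit n.+1) t)) = \pi t.
  by rewrite reprK.
by apply/simplex_orbitP; exists g; rewrite [in LHS]tE.
Qed.
End Orbits.

(* The completion of the free R-module on the orbits for the l^1-norm is the space
   of absolutely summable functions on the set of orbits; the latter condition is
   the predicate [ell1 setT]. *)
Notation ell1_chain R G n := (simplex_orbit G n -> R^o).

Section Ell1Homology.
Variables (R : realType) (G : groupType).

(* The continuous extension of the simplicial boundary: the coefficient of the
   orbit [o] collects those of all the orbits whose i-th face is [o]. On a basis
   element it is the alternating sum of the faces, see [ell1_boundary_basis]. *)
Definition ell1_boundary n (c : ell1_chain R G n.+1) : ell1_chain R G n :=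
  fun o => \sum_(i < n.+2)
    (-1) ^+ i * ell1_sum [set o' | simplex_orbit_face i o' = o] c.

Definition is_ell1_cycle n : ell1_chain R G n -> Prop :=
  match n with
  | 0 => fun _ => True
  | m.+1 => fun c => ell1_boundary c = 0
  end.

Let face_comp n (i : 'I_n.+2) (c : ell1_chain R G n.+1) o :
  ell1 [set: simplex_orbit G n.+1] c -> ell1 [set o' | simplex_orbit_face i o' = o] c.
Proof. exact: ell1_sub. Qed.

Lemma ell1L (T : choiceType) (D : set T) (a : R) (c d : T -> R^o) :
  ell1 D c -> ell1 D d -> ell1 D (a *: c + d).
Proof. by move=> lc ld; exact: (ell1D (ell1Z a lc) ld). Qed.

Lemma ell1_sumL (T : choiceType) (D : set T) (a : R) (c d : T -> R^o) :
  ell1 D c -> ell1 D d ->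
  ell1_sum D (a *: c + d) = a * ell1_sum D c + ell1_sum D d.
Proof.
move=> lc ld; rewrite -ell1_sumZ//.
exact: (ell1_sumD (ell1Z a lc) ld).
Qed.

Lemma ell1_boundaryL n (a : R) (c d : ell1_chain R G n.+1) :
  ell1 setT c -> ell1 setT d ->
  ell1_boundary (a *: c + d) = a *: ell1_boundary c + ell1_boundary d.
Proof.
move=> lc ld; apply/funext => o; rewrite /ell1_boundary !fctE scaler_sumr -big_split.
apply: eq_bigr => i _ /=; rewrite ell1_sumL; [|exact: face_comp|exact: face_comp].
by rewrite mulrDr /GRing.scale /= mulrCA.
Qed.

Lemma ell1_boundary0 n : ell1_boundary (0 : ell1_chain R G n.+1) = 0.
Proof. by apply/funext => o; apply: big1 => i _; rewrite ell1_sum0 mulr0. Qed.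

Lemma ell1_boundary_ell1 n (c : ell1_chain R G n.+1) :
  ell1 setT c -> ell1 setT (ell1_boundary c).
Proof.
move=> lc; apply: ell1_big => i; apply: ell1Z.
exact: ell1_fiber.
Qed.

Definition ell1_cycle n : {pred ell1_chain R G n} :=
  fun c => `[< ell1 setT c /\ is_ell1_cycle c >].

Fact ell1_cycle_submod n : GRing.subsemimod_closed (@ell1_cycle n).
Proof.
have L (a : R) c d : c \in @ell1_cycle n -> d \in @ell1_cycle n ->
    a *: c + d \in @ell1_cycle n.
  move=> /asboolP[lc dc] /asboolP[ld dd]; apply/asboolP; split.
    exact: ell1L.
  case: n c d lc dc ld dd => [//|n] c d lc /= dc ld dd.
  by rewrite ell1_boundaryL// dc dd scaler0 addr0.
have Z0 : 0 \in @ell1_cycle n.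
  apply/asboolP; split; first exact: ell1_0.
  by case: n {L} => [//|n]; exact: ell1_boundary0.
split; first split => //.
  by move=> c d Zc Zd; rewrite -[c]scale1r L.
by move=> a c Zc; rewrite -[_ *: _]addr0 L.
Qed.
HB.instance Definition _ n := GRing.isSubmodClosed.Build R (ell1_chain R G n)
  (@ell1_cycle n) (@ell1_cycle_submod n).

Record ell1_cycleType n :=
  Ell1Cycle { ell1_cycle_val : ell1_chain R G n;
              _ : ell1_cycle_val \in @ell1_cycle n }.
HB.instance Definition _ n := [isSub for @ell1_cycle_val n].
HB.instance Definition _ n := [Choice of ell1_cycleType n by <:].
HB.instance Definition _ n := [SubChoice_isSubZmodule of ell1_cycleType n by <:].
HB.instance Definition _ n := [SubZmodule_isSubLmodule of ell1_cycleType n by <:].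

Definition ell1_bounding n : {pred ell1_cycleType n} :=
  fun z => `[< exists2 b : ell1_chain R G n.+1,
                 ell1 setT b & val z = ell1_boundary b >].

Fact ell1_bounding_submod n : submod_closed (@ell1_bounding n).
Proof.
split; first by apply/asboolP; exists 0; [exact: ell1_0|rewrite ell1_boundary0].
move=> a y z /asboolP[b lb yb] /asboolP[d ld zd]; apply/asboolP.
exists (a *: b + d); first exact: ell1L.
by rewrite ell1_boundaryL// -yb -zd.
Qed.

Definition ell1_homology n := lmod_quot (@ell1_bounding_submod n).

(* For a [G]-invariant cochain [f], the value at an orbit is that at any
   representative. *)
Definition eval_cochain n (f : cochain R G n) (c : ell1_chain R G n) : R :=
  ell1_sum [set: simplex_orbit G n] (fun o => f (repr o) * c o).

(* Defined on representatives; see [ell1_pairing_pi]. *)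
Definition ell1_pairing n (x : bcohomology R G n) (y : ell1_homology n) : R :=
  eval_cochain (val (repr x)) (val (repr y)).

Definition ell1_detectable n (x : bcohomology R G n) : Prop :=
  exists y : ell1_homology n, ell1_pairing x y != 0.

Lemma ell1_boundary_basis n (a : simplex_orbit G n.+1) (o : simplex_orbit G n) :
  ell1_boundary (fun x => (x == a)%:R : R^o) o =
  \sum_(i < n.+2) (-1) ^+ i * (o == simplex_orbit_face i a)%:R.
Proof.
apply: eq_bigr => i _; congr (_ * _); rewrite ell1_sum_indic.
by rewrite eq_sym; congr (nat_of_bool _)%:R; apply/asboolP/eqP.
Qed.

Lemma eval_ell1 n (f : cochain R G n) (c : ell1_chain R G n) :
  bcochain f -> ell1 setT c ->
  ell1 [set: simplex_orbit G n] (fun o => f (repr o) * c o).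
Proof.
move=> [[M fM] _] lc; apply: (ell1_le (ell1Z M lc)) => o _ /=.
by rewrite !normrM ler_wpM2r// (le_trans (fM _))// ler_norm.
Qed.

Lemma eval_cochainLl n (a : R) (f g : cochain R G n) (c : ell1_chain R G n) :
  bcochain f -> bcochain g -> ell1 setT c ->
  eval_cochain (a *: f + g) c = a * eval_cochain f c + eval_cochain g c.
Proof.
move=> bf bg lc; rewrite /eval_cochain -ell1_sumL; [|exact: eval_ell1..].
by apply: eq_ell1_sum => o _; rewrite !fctE mulrDl scalerAl.
Qed.

Lemma eval_cochainLr n (a : R) (f : cochain R G n) (c d : ell1_chain R G n) :
  bcochain f -> ell1 setT c -> ell1 setT d ->
  eval_cochain f (a *: c + d) = a * eval_cochain f c + eval_cochain f d.
Proof.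
move=> bf lc ld; rewrite /eval_cochain -ell1_sumL; [|exact: eval_ell1..].
by apply: eq_ell1_sum => o _; rewrite !fctE mulrDr -scalerAr.
Qed.

Lemma eval_coboundary n (f : cochain R G n) (c : ell1_chain R G n.+1) :
  bcochain f -> ell1 setT c ->
  eval_cochain (coboundary f) c = eval_cochain f (ell1_boundary c).
Proof.
move=> bf lc; have [[M fM] fG] := bf.
have frepr t : f (repr (\pi_(simplex_orbit G n) t)) = f t.
  have /simplex_orbitP[g tE] :
      \pi_(simplex_orbit G n) (repr (\pi_(simplex_orbit G n) t)) = \pi t.
    by rewrite reprK.
  by rewrite [in RHS]tE fG.
pose u i (o' : simplex_orbit G n.+1) := f (repr (simplex_orbit_face i o')) * c o'.
have lu i : ell1 [set: simplex_orbit G n.+1] (u i).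
  apply: (ell1_le (ell1Z M lc)) => o _ /=.
  by rewrite !normrM ler_wpM2r// (le_trans (fM _))// ler_norm.
have uE i o : ell1_sum [set o' | simplex_orbit_face i o' = o] (u i) =
    f (repr o) * ell1_sum [set o' | simplex_orbit_face i o' = o] c.
  rewrite -ell1_sumZ; last exact: face_comp.
  by apply: eq_ell1_sum => o' <-.
transitivity (\sum_(i < n.+2) (-1) ^+ i * ell1_sum setT (u i)).
  under eq_bigr do rewrite -ell1_sumZ//.
  rewrite -ell1_sum_big; last by move=> i; exact: ell1Z.
  apply: eq_ell1_sum => o _; rewrite /coboundary mulr_suml.
  by apply: eq_bigr => i _ /=; rewrite -mulrA /u /simplex_orbit_face frepr.
have lw i := ell1_fiber (simplex_orbit_face i) (lu i).
under eq_bigr => i do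
  rewrite -(ell1_sum_fiber (simplex_orbit_face i) (lu i)) -(ell1_sumZ _ (lw i)).
rewrite -ell1_sum_big; last by move=> i; exact: ell1Z.
apply: eq_ell1_sum => o _; rewrite /ell1_boundary mulr_sumr.
by apply: eq_bigr => i _ /=; rewrite uE mulrCA.
Qed.

Lemma eval_bcoboundary n (f : cochain R G n) (c : ell1_chain R G n) :
  is_bcoboundary f -> c \in @ell1_cycle n -> eval_cochain f c = 0.
Proof.
move=> + /asboolP[lc]; case: n f c lc => [|n] f c lc /=.
  move=> -> _; rewrite -[RHS](ell1_sum0 R [set: simplex_orbit G 0]).
  by apply: eq_ell1_sum => o _; exact: mul0r.
move=> [g bg ->] dc; rewrite eval_coboundary// dc.
rewrite -[RHS](ell1_sum0 R [set: simplex_orbit G n]).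
by apply: eq_ell1_sum => o _; exact: mulr0.
Qed.

Lemma eval_ell1_boundary n (f : cochain R G n) (b : ell1_chain R G n.+1) :
  f \in @bcocycle R G n -> ell1 setT b -> eval_cochain f (ell1_boundary b) = 0.
Proof.
move=> /asboolP[bf df] lb; rewrite -eval_coboundary// df.
rewrite -[RHS](ell1_sum0 R [set: simplex_orbit G n.+1]).
by apply: eq_ell1_sum => o _; exact: mul0r.
Qed.

Lemma ell1_pairing_pi n (z : bcocycleType R G n) (c : ell1_cycleType n) :
  ell1_pairing (\pi_(bcohomology R G n) z) (\pi_(ell1_homology n) c) =
  eval_cochain (val z) (val c).
Proof.
rewrite /ell1_pairing; set z' := repr (_ z); set c' := repr (_ c).
have /asboolP Bz : z' - z \in @bcobounding R G n.
  exact: lmod_quot_reprP.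
have /asboolP[b lb Bc] : c' - c \in @ell1_bounding n.
  exact: lmod_quot_reprP.
have /asboolP[bz _] := valP z; have /asboolP[bz' _] := valP z'.
have /asboolP[lc _] := valP c; have /asboolP[lc' _] := valP c'.
have Dz : val z' = 1 *: val (z' - z) + val z.
  by rewrite scale1r; apply/funext => t; rewrite !fctE /= subrK.
have Dc : val c' = 1 *: val (c' - c) + val c.
  by rewrite scale1r; apply/funext => t; rewrite !fctE /= subrK.
have /asboolP[bzz _] := valP (z' - z).
rewrite Dz eval_cochainLl// eval_bcoboundary// ?mulr0 ?add0r; last exact: valP.
rewrite Dc eval_cochainLr//; last by have /asboolP[] := valP (c' - c).
by rewrite Bc eval_ell1_boundary ?mulr0 ?add0r//; exact: valP.
Qed.
End Ell1Homology.

Definition Lex (R : realType) (L : groupType) : Prop :=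
  forall (G : groupType) (f : {multiplicative G -> L}),
    (forall y, exists x, f x = y) ->
    forall n, injective (@bcohomology_map R G L f n).

(* Main.v *)
From HB Require Import structures.
Require Import Defs.
From mathcomp Require Import all_boot all_order all_algebra reals.
From mathcomp Require Import ring boolp classical_sets functions ereal esum.

Set Implicit Arguments.
Unset Strict Implicit.
Unset Printing Implicit Defensive.

Import Order.TTheory GRing.Theory Num.Theory.
Local Open Scope ring_scope.

(* Let z be the cocycle z1 x z2 x z3 on L1 x L2 x L3 built from cocycles of the
   three classes. By (C), its pullback to (L1 * L2) x L3 is the cross product of a
   coboundary with z3, hence a coboundary. If z itself were a coboundary, take the
   slant product with an l^1-cycle c3 detecting z3, defined through the shuffle
   (Eilenberg-Zilber) map: it sends coboundaries to coboundaries and, when z1 x z2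
   is normalized, it sends z to <z3, c3> (z1 x z2). So z1 x z2 is a coboundary, and
   slanting once more, so is z1, which contradicts its detectability. Cochains are
   handled as functions on lists, on which the coboundary, the shuffle map and the
   normalization are defined by recursion through the cone with apex the first
   vertex. *)

(** * Coboundary, normalization and its homotopy on lists *)

Section ListCochains.
Variables (R : comPzRingType) (T : Type).
Implicit Types (F E : seq T -> R) (s t : seq T) (n : nat).

(* Augmented: on a vertex, [lcobound F [:: x] = F [::]]. *)
Fixpoint lcobound F s : R :=
  if s is x :: s' then F s' - lcobound (F \o cons x) s' else 0.

Lemma eq_lcobound F E s :
  (forall t, (size t).+1 = size s -> F t = E t) -> lcobound F s = lcobound E s.
Proof.
elim: s F E => //= x s IHs F E FE; rewrite FE//; congr (_ - _).
by apply: IHs => t ts /=; apply: FE; rewrite /= ts.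
Qed.

Lemma lcobound0 s : lcobound (fun=> 0) s = 0.
Proof.
elim: s => //= x s IHs; rewrite -[X in lcobound X]/(fun _ : seq T => 0 : R).
by rewrite IHs subrr.
Qed.

Lemma lcoboundD F E s :
  lcobound (fun t => F t + E t) s = lcobound F s + lcobound E s.
Proof.
elim: s F E => [|x s IHs] F E /=; first by rewrite addr0.
by rewrite (IHs (F \o cons x) (E \o cons x)); ring.
Qed.

Lemma lcoboundZ a F s : lcobound (fun t => a * F t) s = a * lcobound F s.
Proof.
elim: s F => [|x s IHs] F /=; first by rewrite mulr0.
by rewrite (IHs (F \o cons x)); ring.
Qed.

Lemma lcoboundB F E s :
  lcobound (fun t => F t - E t) s = lcobound F s - lcobound E s.
Proof.
elim: s F E => [|x s IHs] F E /=; first by rewrite subr0.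
by rewrite (IHs (F \o cons x) (E \o cons x)); ring.
Qed.

(** Since [lcobound F \o cons x] is [F - lcobound (F \o cons x)], the terms in [F] cancel and a
    double coboundary on the shorter list remains. *)
Lemma lcobound_lcobound F s : lcobound (lcobound F) s = 0.
Proof.
elim: s F => //= x s IHs F.
rewrite (@eq_lcobound (_ \o _) (fun t => F t - lcobound (F \o cons x) t))//.
by rewrite lcoboundB IHs subr0 subrr.
Qed.

Lemma lcobound_degenerate F n :
  (forall a x b, size (a ++ x :: x :: b) = n -> F (a ++ x :: x :: b) = 0) ->
  forall a x b, size (a ++ x :: x :: b) = n.+1 ->
  lcobound F (a ++ x :: x :: b) = 0.
Proof.
move=> + a; elim: a F n => [|y a IHa] F n F0 x b /=.
  move=> [sb]; rewrite opprB addrC addrNK -[RHS](lcobound0 b).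
  by apply: eq_lcobound => t tb; apply: (F0 [::]); rewrite /= tb.
move=> [sn]; rewrite F0// sub0r; case: n => [|n] in F0 sn *.
  by move: sn; rewrite size_cat /= addnS.
rewrite (IHa _ n)// ?oppr0// => a' x' b' sa' /=.
by apply: (F0 (y :: a')); rewrite /= sa'.
Qed.

(* [N x = x_0 . N (bd x)], where [x_0 . _] is the cone with apex [x_0]. *)
Fixpoint lnormal_rec n F s : R :=
  match n, s with
  | m.+1, x :: _ => lcobound (lnormal_rec m (F \o cons x)) s
  | _, _ => F s
  end.
Definition lnormal F s := lnormal_rec (size s) F s.

Lemma lnormal_cons F x s :
  lnormal F (x :: s) = lcobound (lnormal (F \o cons x)) (x :: s).
Proof. by apply: eq_lcobound => t [ts]; rewrite /lnormal ts. Qed.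

Lemma lnormalB F E s : lnormal (fun t => F t - E t) s = lnormal F s - lnormal E s.
Proof.
have [n] := ubnP (size s); elim: n s F E => // n IHn [//|x s] F E sn.
rewrite !lnormal_cons -lcoboundB; apply: eq_lcobound => t ts.
by apply: IHn; rewrite ts.
Qed.

(** When [lcobound F \o cons x] is expanded, induction makes its second term a coboundary, which the
    outer [lcobound] kills. *)
Lemma lnormal_lcobound F s : lnormal (lcobound F) s = lcobound (lnormal F) s.
Proof.
have [n] := ubnP (size s); elim: n s F => // n IHn [//|x s] F sn.
rewrite lnormal_cons.
under eq_lcobound => t ts.
  rewrite -[_ \o _]/(fun t => F t - lcobound (F \o cons x) t) lnormalB IHn ?ts//.
  over.
by rewrite lcoboundB lcobound_lcobound subr0.
Qed.

(* In [bd x] the two faces omitting one of the equal vertices cancel, and the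
   others are degenerate. *)
Lemma lnormal_degenerate F a x b : lnormal F (a ++ x :: x :: b) = 0.
Proof.
have [n] := ubnP (size (a ++ x :: x :: b)); elim: n a x b F => // n IHn a x b F sn.
have -> : lnormal F (a ++ x :: x :: b) =
    lcobound (lnormal (F \o cons (head x a))) (a ++ x :: x :: b).
  by case: a sn => [|y a] _; rewrite lnormal_cons.
apply: (@lcobound_degenerate _ (size (a ++ x :: x :: b)).-1).
  move=> a' x' b' sE; apply: IHn; rewrite sE -ltnS prednK//.
  by rewrite size_cat /= addnS.
by rewrite prednK// size_cat /= addnS.
Qed.

(* [h x = x_0 . (x - N x - h (bd x))]. *)
Fixpoint lhomotopy_rec n F s : R :=
  match n, s with
  | m.+1, x :: _ => F (x :: s) - lnormal (F \o cons x) s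
                    - lcobound (lhomotopy_rec m (F \o cons x)) s
  | _, _ => 0
  end.
Definition lhomotopy F s := lhomotopy_rec (size s) F s.

Lemma lhomotopy_cons F x s : lhomotopy F (x :: s) = F [:: x, x & s]
  - lnormal (F \o cons x) (x :: s) - lcobound (lhomotopy (F \o cons x)) (x :: s).
Proof.
congr (_ - _); apply: eq_lcobound => t [ts].
by rewrite /lhomotopy ts.
Qed.

Lemma lhomotopyB F E s :
  lhomotopy (fun t => F t - E t) s = lhomotopy F s - lhomotopy E s.
Proof.
have [n] := ubnP (size s); elim: n s F E => [//|n IHn] [|x s] F E sn.
  by rewrite /lhomotopy /= subr0.
rewrite !lhomotopy_cons.
have -> : lnormal ((fun t => F t - E t) \o cons x) (x :: s) =
  lnormal (F \o cons x) (x :: s) - lnormal (E \o cons x) (x :: s).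
  exact: lnormalB.
suff -> : lcobound (lhomotopy ((fun t => F t - E t) \o cons x)) (x :: s) =
  lcobound (lhomotopy (F \o cons x)) (x :: s) -
  lcobound (lhomotopy (E \o cons x)) (x :: s).
  by ring.
rewrite -lcoboundB; apply: eq_lcobound => t ts; apply: IHn; by rewrite ts.
Qed.

(** The recursion for [lhomotopy] solves this equation: by induction,
    [lhomotopy (lcobound (F \o cons x))] can be rewritten on the faces, and its term
    [lcobound (lhomotopy (F \o cons x))] dies under the outer [lcobound]. *)
Lemma lhomotopyP F s :
  F s - lnormal F s = lcobound (lhomotopy F) s + lhomotopy (lcobound F) s.
Proof.
have [n] := ubnP (size s); elim: n s F => [//|n IHn] [|x s] F sn.
  by rewrite /lhomotopy /lnormal /= subrr addr0.
rewrite [lhomotopy (lcobound F) _]lhomotopy_cons.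
have -> : lcobound F \o cons x = fun t => F t - lcobound (F \o cons x) t by [].
rewrite lnormalB lnormal_lcobound.
have -> : lcobound (lhomotopy (fun t => F t - lcobound (F \o cons x) t)) (x :: s) =
    lcobound (lhomotopy F) (x :: s) - lcobound (F \o cons x) (x :: s)
    + lcobound (lnormal (F \o cons x)) (x :: s).
  have -> : lcobound (lhomotopy (fun t => F t - lcobound (F \o cons x) t)) (x :: s) =
      lcobound (fun t => lhomotopy F t - (((F \o cons x) t - lnormal (F \o cons x) t)
        - lcobound (lhomotopy (F \o cons x)) t)) (x :: s).
    apply: eq_lcobound => t [ts]; rewrite lhomotopyB IHn ?ts//; ring.
  rewrite !lcoboundB lcobound_lcobound; ring.
rewrite -[lcobound F _]/(F (x :: s) - lcobound (F \o cons x) (x :: s)); ring.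
Qed.
End ListCochains.

(** * Naturality in the vertices *)

Section ListNaturality.
Variables (R : comPzRingType) (T T' : Type) (h : T -> T').
Implicit Types (F : seq T' -> R) (s : seq T).

Lemma lcobound_map F s : lcobound F (map h s) = lcobound (F \o map h) s.
Proof. by elim: s F => //= x s IHs F; rewrite IHs. Qed.

Lemma lnormal_map F s : lnormal F (map h s) = lnormal (F \o map h) s.
Proof.
have [n] := ubnP (size s); elim: n s F => // n IHn [//|x s] F sn.
rewrite [map h _]/= !lnormal_cons -[_ :: _]/(map h (x :: s)) lcobound_map.
by apply: eq_lcobound => t ts; rewrite /= IHn ?ts.
Qed.

Lemma lhomotopy_map F s : lhomotopy F (map h s) = lhomotopy (F \o map h) s.
Proof.
have [n] := ubnP (size s); elim: n s F => // n IHn [//|x s] F sn.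
rewrite [map h _]/= !lhomotopy_cons -[h x :: map h s]/(map h (x :: s)).
rewrite lcobound_map lnormal_map; congr (_ - _).
by apply: eq_lcobound => t ts; rewrite /= IHn ?ts.
Qed.
End ListNaturality.

(** * The shuffle map *)

Section Shuffle.
Variables (R : comPzRingType) (T U : Type).
Implicit Types (F E : seq (T * U) -> R) (x : seq T) (y : seq U).

(* The signed sum of [F] over the monotone lattice paths of the grid [x * y]. The
   value at [x = [::]] makes [shuffle_lcobound] hold without side condition. *)
Fixpoint shuffle x F y : R :=
  match x with
  | [::] => if y is [:: _] then F [::] else 0
  | x0 :: x' => (fix shuffle_cons F y :=
      if y is y0 :: y' then
        shuffle x' (F \o cons (x0, y0)) y
        + (-1) ^+ size x' * shuffle_cons (F \o cons (x0, y0)) y'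
      else 0) F y
  end.

Lemma shuffle_cons (x0 : T) x F (y0 : U) y : shuffle (x0 :: x) F (y0 :: y) =
  shuffle x (F \o cons (x0, y0)) (y0 :: y)
  + (-1) ^+ size x * shuffle (x0 :: x) (F \o cons (x0, y0)) y.
Proof. by []. Qed.

Lemma shuffle_nilr x F : shuffle x F [::] = 0. Proof. by case: x. Qed.

Lemma shuffleB x F E y :
  shuffle x (fun t => F t - E t) y = shuffle x F y - shuffle x E y.
Proof.
elim: x F E y => [|x0 x IHx] F E y; first by case: y => [|? []] //=; rewrite subr0.
elim: y F E => [|y0 y IHy] F E; first by rewrite subr0.
rewrite !shuffle_cons.
have := IHx (F \o cons (x0, y0)) (E \o cons (x0, y0)) (y0 :: y).
have := IHy (F \o cons (x0, y0)) (E \o cons (x0, y0)).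
rewrite /comp => -> ->; ring.
Qed.

Lemma shuffle0 x y : shuffle x (fun=> 0) y = 0.
Proof.
elim: x y => [|x0 x IHx]; first by case => [|? []].
elim=> [//|y0 y IHy]; rewrite shuffle_cons.
rewrite -[_ \o _]/(fun _ : seq (T * U) => 0 : R) IHx IHy mulr0 addr0//.
Qed.

(** The Leibniz rule, dual to the shuffle map being a chain map: a face omitting a corner is shared
    by the two paths around a square and cancels; every other face omits a column or a row of the
    grid. *)
Lemma shuffle_lcobound x F y : shuffle x (lcobound F) y =
  lcobound (fun x' => shuffle x' F y) x
  + (-1) ^+ (size x).+1 * lcobound (shuffle x F) y.
Proof.
elim: x F y => [|x0 x IHx] F y.
  (* For empty [x], nonzero terms occur only if [y] has two vertices, and then its two faces
     cancel. *)
  rewrite /= add0r expr1; case: y => [|y0 [|y1 [|y2 y]]] //=; try by rewrite !subr0 mulr0.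
  - by rewrite mulr0.
  - by rewrite !subr0 subrr mulr0.
  - rewrite -[X in lcobound X]/(fun _ : seq U => 0 : R) lcobound0; ring.
elim: y F => [|y0 y IHy] F.
  rewrite /= shuffle_nilr mulr0 addr0 sub0r.
  rewrite -[X in lcobound X]/(fun _ : seq T => 0 : R) lcobound0 oppr0//.
pose F' := F \o cons (x0, y0).
have E x' y' : shuffle x' (lcobound F \o cons (x0, y0)) y' =
    shuffle x' F y' - shuffle x' (lcobound F') y'.
  by rewrite -shuffleB.
rewrite shuffle_cons !E IHx IHy /=.
have -> : lcobound ((fun x' => shuffle x' F (y0 :: y)) \o cons x0) x =
    lcobound (fun x' => shuffle x' F' (y0 :: y)) x
    - (-1) ^+ size x * lcobound (fun x' => shuffle (x0 :: x') F' y) x.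
  rewrite -lcoboundZ -lcoboundB; apply: eq_lcobound => t ts.
  by rewrite [LHS]shuffle_cons -ts exprS mulN1r mulNr opprK.
have -> : lcobound (shuffle (x0 :: x) F \o cons y0) y =
    lcobound (shuffle x F' \o cons y0) y
    + (-1) ^+ size x * lcobound (shuffle (x0 :: x) F') y.
  by rewrite -lcoboundZ -lcoboundD; apply: eq_lcobound => t ts.
rewrite !exprS -/F'.
rewrite -[lcobound ((fun x' => shuffle x' F' y) \o cons x0) x]/(
  lcobound (fun x' => shuffle (x0 :: x') F' y) x).
have := sqrr_sign R (size x); rewrite expr2; set e := (-1) ^+ _ => e2.
ring: e2.
Qed.


Lemma shuffle_point (x0 : T) c (g : seq U -> R) y :
  shuffle [:: x0] (fun t => c * g (unzip2 t)) y = if nilp y then 0 else c * g y.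
Proof.
elim: y g => [//|y0 [|y1 y] IHy] g; first by rewrite /= mulr0 addr0.
rewrite shuffle_cons add0r mul1r.
exact: (IHy (g \o cons y0)).
Qed.

(* All the paths but the one that exhausts [x] first repeat a vertex of [x] among
   their first [size x] vertices. *)
Lemma shuffle_cross p (f : seq T -> R) (g : seq U -> R) x y :
  (forall a z b, f (a ++ z :: z :: b) = 0) -> size x = p.+1 -> ~~ nilp y ->
  shuffle x (fun t => f (take p.+1 (unzip1 t)) * g (drop p (unzip2 t))) y =
  f x * g y.
Proof.
elim: p f x y => [|p IHp] f [//|x0 x] [//|y0 y] f0 [sx] _.
  case: x sx => // _; rewrite shuffle_cons mul1r.
  have -> : (fun t => f (take 1 (unzip1 t)) * g (drop 0 (unzip2 t))) \o cons (x0, y0) =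
      fun t => f [:: x0] * (g \o cons y0) (unzip2 t).
    by apply/funext => t /=; rewrite take0.
  by rewrite shuffle_point; case: y => [|y1 y]; rewrite ?addr0 ?add0r.
rewrite shuffle_cons.
rewrite [X in _ + _ * X](_ : _ = 0) ?mulr0 ?addr0; last first.
  case: y => [|y1 y]; first by rewrite shuffle_nilr.
  rewrite shuffle_cons.
  have -> : (fun t => f (take p.+2 (unzip1 t)) * g (drop p.+1 (unzip2 t)))
      \o cons (x0, y0) \o cons (x0, y1) = fun=> 0.
    by apply/funext => t /=; rewrite (f0 [::]) mul0r.
  by rewrite !shuffle0 mulr0 addr0.
apply: (IHp (f \o cons x0)) => // a z b.
exact: (f0 (x0 :: a)).
Qed.
End Shuffle.

Lemma shuffle_map (R : comPzRingType) (T T' U U' : Type) (h : T -> T')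
    (k : U -> U') x (F : seq (T' * U') -> R) y :
  shuffle (map h x) F (map k y) =
  shuffle x (F \o map (fun u => (h u.1, k u.2))) y.
Proof.
elim: x F y => [|x0 x IHx] F y; first by case: y => [|y0 []].
elim: y F => [//|y0 y IHy] F.
rewrite [map h _]/= [map k _]/= !shuffle_cons -[_ :: map k _]/(map k (y0 :: y)).
by rewrite IHx -[_ :: map h _]/(map h (x0 :: x)) IHy size_map.
Qed.

(** * Bounds in terms of the length *)

Section ListBounds.
Variables (R : numDomainType) (T : Type).
Implicit Types (F : seq T -> R) (s : seq T) (M : R).

Lemma lcobound_le M F s :
  (forall t, (size t).+1 = size s -> `|F t| <= M) ->
  `|lcobound F s| <= (size s)%:R * M.
Proof.
elim: s F => [|x s IHs] F FM /=; first by rewrite normr0 mul0r.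
rewrite (le_trans (ler_normB _ _))// -add1n natrD mulrDl mul1r lerD ?FM//.
by apply: IHs => t ts /=; apply: FM; rewrite /= ts.
Qed.

Lemma lnormal_le M F s : (forall t, `|F t| <= M) ->
  `|lnormal F s| <= (size s)`!%:R * M.
Proof.
have [n] := ubnP (size s); elim: n s F => // n IHn [|x s] F sn FM.
  by rewrite mul1r; exact: FM.
rewrite lnormal_cons /= factS natrM -mulrA.
apply: (@lcobound_le _ _ (x :: s)) => t [ts].
by rewrite -ts; apply: IHn; rewrite ?ts// => u; exact: FM.
Qed.

(** The bound has to be uniform in [F], because the recursion replaces [F] by [F \o cons x] with
    varying [x]. *)
Lemma lhomotopy_bounded M n : exists K, forall F s,
  (forall t, `|F t| <= M) -> size s = n -> `|lhomotopy F s| <= K.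
Proof.
elim: n => [|n [K KP]]; first by exists 0 => F [|//] _ _; rewrite normr0.
exists (M + (n.+1)`!%:R * M + n.+1%:R * K) => F [//|x s] FM [sn].
rewrite lhomotopy_cons (le_trans (ler_normB _ _))// lerD//.
  rewrite (le_trans (ler_normB _ _))// lerD// -sn.
  by apply: (@lnormal_le _ _ (x :: s)) => t; exact: FM.
rewrite -sn; apply: (@lcobound_le _ _ (x :: s)) => t [ts].
by apply: KP; rewrite ?ts// => u; exact: FM.
Qed.
End ListBounds.

Lemma shuffle_le (R : numDomainType) (T U : Type) (M : R) x
    (F : seq (T * U) -> R) y :
  (forall t, `|F t| <= M) -> `|shuffle x F y| <= (2 ^ (size x + size y))%:R * M.
Proof.
move=> FM; have M0 : 0 <= M by apply: le_trans (FM [::]).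
elim: x F FM y => [|x0 x IHx] F FM y.
  case: y => [|y0 [|y1 y]] /=; rewrite ?normr0 ?mulr_ge0//.
  by rewrite (le_trans (FM _))// ler_peMl// ler1n expn_gt0.
elim: y F FM => [|y0 y IHy] F FM; first by rewrite normr0 mulr_ge0.
rewrite shuffle_cons (le_trans (ler_normD _ _))//.
rewrite addSn expnS mul2n -addnn natrD mulrDl lerD//.
  by apply: (IHx (F \o _)) => t; exact: FM.
rewrite normrM normrX normrN1 expr1n mul1r /= addnS -addSn.
by apply: (IHy (F \o _)) => t; exact: FM.
Qed.

(** * Homogeneous simplices as lists *)

Section SimplexSeq.
Variable T : Type.

Definition simplex_seq n (t : 'I_n -> T) : seq T := [seq t i | i <- enum 'I_n].

Lemma size_simplex_seq n (t : 'I_n -> T) : size (simplex_seq t) = n.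
Proof. by rewrite size_map size_enum_ord. Qed.

Lemma simplex_seq_cons n (t : 'I_n.+1 -> T) :
  simplex_seq t = t ord0 :: simplex_seq (t \o lift ord0).
Proof. by rewrite /simplex_seq enum_ordSl /= -map_comp. Qed.

Lemma nth_simplex_seq n (t : 'I_n.+1 -> T) x0 i :
  (i < n.+1)%N -> nth x0 (simplex_seq t) i = t (inord i).
Proof.
move=> ilt; rewrite (nth_map ord0) ?size_enum_ord//; congr t.
by apply: val_inj; rewrite /= nth_enum_ord// inordK.
Qed.

Lemma simplex_seq_nth x0 n s :
  size s = n.+1 -> simplex_seq (fun i : 'I_n.+1 => nth x0 s i) = s.
Proof.
move=> sn; apply: (@eq_from_nth _ x0); rewrite size_simplex_seq ?sn// => i ilt.
by rewrite nth_simplex_seq// inordK.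
Qed.

Lemma lcobound_simplex_seq (R : comPzRingType) (F : seq T -> R) n
    (t : 'I_n.+1 -> T) :
  lcobound F (simplex_seq t) =
  \sum_(i < n.+1) (-1) ^+ i * F (simplex_seq (t \o lift i)).
Proof.
elim: n F t => [|n IHn] F t; rewrite simplex_seq_cons.
  by rewrite big_ord_recl big_ord0 /simplex_seq enum_ord0 /= !mul1r subr0 addr0.
rewrite big_ord_recl mul1r [LHS]/= IHn -sumrN; congr (_ + _).
apply: eq_bigr => i _; rewrite [in RHS]exprS mulN1r mulNr; congr (- (_ * F _)).
rewrite [in RHS]simplex_seq_cons /=.
(* The simplicial identity: omitting vertex 0 and then vertex [i] is omitting vertex [i.+1] and then
   vertex 0. *)
have -> : (t \o lift ord0) \o lift i = (t \o lift (lift ord0 i)) \o lift ord0.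
  apply/funext => j /=; congr t; apply: val_inj.
  by rewrite /= /bump /= !add1n ltnS addnS.
congr (_ :: _); congr t; exact: val_inj.
Qed.
End SimplexSeq.

Lemma simplex_seq_comp (T T' : Type) (h : T -> T') n (t : 'I_n -> T) :
  simplex_seq (h \o t) = map h (simplex_seq t).
Proof. by rewrite /simplex_seq -map_comp. Qed.

(** * Group cochains on lists and normalization of bounded cocycles *)

Local Notation lmulg g := (fun x => (g * x)%g).

Section SeqCochain.
Variables (R : realType) (G : groupType).

(* Extension by 0 to the lists of the wrong length, which makes
   [lcobound_seq_cochain] unconditional. *)
Definition seq_cochain n (f : cochain R G n) (s : seq G) : R :=
  if size s == n.+1 then f (fun i => nth 1%g s i) else 0.

Lemma seq_cochain_size n (f : cochain R G n) s :
  size s != n.+1 -> seq_cochain f s = 0.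
Proof. by rewrite /seq_cochain => /negbTE ->. Qed.

Lemma seq_cochainE n (f : cochain R G n) t : seq_cochain f (simplex_seq t) = f t.
Proof.
rewrite /seq_cochain size_simplex_seq eqxx; congr f; apply/funext => i.
by rewrite nth_simplex_seq// inord_val.
Qed.

Lemma coboundary_simplex_seq n (F : seq G -> R) (t : simplex G n.+1) :
  coboundary (fun u => F (simplex_seq u)) t = lcobound F (simplex_seq t).
Proof. by rewrite lcobound_simplex_seq. Qed.

Lemma lcobound_seq_cochain n (f : cochain R G n) s :
  lcobound (seq_cochain f) s = seq_cochain (coboundary f) s.
Proof.
have [sn|sn] := eqVneq (size s) n.+2.
  rewrite -(simplex_seq_nth 1%g sn) seq_cochainE -coboundary_simplex_seq.
  by apply: eq_bigr => i _; rewrite seq_cochainE.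
rewrite [RHS]seq_cochain_size// -[RHS](lcobound0 _ s).
apply: eq_lcobound => t ts; rewrite seq_cochain_size//.
by apply: contraNneq sn => tn; rewrite -ts tn.
Qed.

Lemma seq_cochain_bounded n (f : cochain R G n) :
  bcochain f -> exists M, forall s, `|seq_cochain f s| <= M.
Proof.
move=> [[M fM] _]; exists M => s; rewrite /seq_cochain; case: eqP => // _.
(* [M] is nonnegative, as it bounds the norm of [f] at a constant tuple. *)
by rewrite normr0 (le_trans _ (fM (fun=> 1%g))).
Qed.

Lemma simplex_seq_sact n g (t : simplex G n) :
  simplex_seq (sact g t) = map (lmulg g) (simplex_seq t).
Proof. exact: (simplex_seq_comp (lmulg g) t). Qed.

Lemma seq_cochain_map n (f : cochain R G n) g s :
  bcochain f -> seq_cochain f (map (lmulg g) s) = seq_cochain f s.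
Proof.
move=> [_ fG]; have [sn|sn] := eqVneq (size s) n.+1; last first.
  by rewrite !seq_cochain_size ?size_map.
by rewrite -(simplex_seq_nth 1%g sn) -simplex_seq_sact !seq_cochainE fG.
Qed.

Lemma bcochain_simplex_seq n (F : seq G -> R) M :
  (forall s, size s = n.+1 -> `|F s| <= M) ->
  (forall g s, F (map (lmulg g) s) = F s) ->
  bcochain (fun t : simplex G n => F (simplex_seq t)).
Proof.
move=> FM FG; split; first by exists M => t; rewrite FM ?size_simplex_seq.
by move=> g t; rewrite simplex_seq_sact FG.
Qed.

(** Normalization and its homotopy are natural, hence compatible with left translations, and bounded
    in a fixed degree. So in positive degree the homotopy yields a bounded invariant primitive of
    the difference. *)
Lemma normalized_bcocycle n (f : cochain R G n) : f \in @bcocycle R G n ->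
  exists f' : cochain R G n, [/\ f' \in @bcocycle R G n, is_bcoboundary (f - f')
    & forall a x b, seq_cochain f' (a ++ x :: x :: b) = 0].
Proof.
move=> /asboolP[bf df]; have [M FM] := seq_cochain_bounded bf.
pose F := seq_cochain f.
have dF : lcobound F = fun=> 0.
  by apply/funext => s; rewrite lcobound_seq_cochain df /seq_cochain; case: ifP.
have FG g : F \o map (lmulg g) = F.
  by apply/funext => s; rewrite /= /F seq_cochain_map.
exists (fun t => lnormal F (simplex_seq t)); split.
- apply/asboolP; split.
    apply: (@bcochain_simplex_seq _ (lnormal F) ((n.+1)`!%:R * M)).
      by move=> s <-; exact: lnormal_le.
    by move=> g s; rewrite lnormal_map FG.
  apply/funext => t; rewrite coboundary_simplex_seq -lnormal_lcobound dF.
  by have := lnormalB (fun=> 0) (fun=> 0 : R) (simplex_seq t); rewrite !subrr => ->.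
- have E s : F s - lnormal F s = lcobound (lhomotopy F) s.
    rewrite lhomotopyP dF; have := lhomotopyB (fun=> 0) (fun=> 0 : R) s.
    by rewrite !subrr => ->; rewrite addr0.
  have fE t : (f - (fun t => lnormal F (simplex_seq t) : R^o)) t =
      lcobound (lhomotopy F) (simplex_seq t).
    by rewrite -E /F seq_cochainE.
  case: n f bf df @F FM dF FG E fE => [|n] f bf df F FM dF FG E fE.
    (* In degree 0 the difference must vanish: the only face of a vertex is empty, where the
       homotopy is 0. *)
    by apply/funext => t; rewrite fE simplex_seq_cons /simplex_seq enum_ord0 /= subr0.
  exists (fun t => lhomotopy F (simplex_seq t)); last first.
    by apply/funext => t; rewrite coboundary_simplex_seq fE.
  have [K KP] := lhomotopy_bounded G M n.+1.
  apply: (@bcochain_simplex_seq _ (lhomotopy F) K); first by move=> s; exact: KP.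
  by move=> g s; rewrite lhomotopy_map FG.
- move=> a x b; have [sn|sn] := eqVneq (size (a ++ x :: x :: b)) n.+1; last first.
    exact: seq_cochain_size.
  rewrite -(simplex_seq_nth 1%g sn) seq_cochainE simplex_seq_nth//.
  exact: lnormal_degenerate.
Qed.
End SeqCochain.

(** * Evaluation on l^1-chains and the slant product *)

Lemma ell1_sum_ge0 (R : realType) (T : choiceType) (D : set T) (u : T -> R) :
  (forall x, 0 <= u x) -> ell1 D u -> 0 <= ell1_sum D u.
Proof.
move=> u0 lu; rewrite (@ell1_sumB _ _ D u u (fun=> 0))//; last 2 first.
- exact: ell1_0.
- by move=> x _; rewrite subr0.
rewrite [X in _ - fine X]esum1// subr0 fine_ge0// esum_ge0// => x _.
by rewrite lee_fin.
Qed.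

(** [K] is [M] times the l^1-norm of [c]; being independent of [f], it bounds the slant product,
    which evaluates a whole family of cochains on [c]. *)
Lemma eval_cochain_bounded (R : realType) (G : groupType) n (M : R)
    (c : ell1_chain R G n) : ell1 setT c ->
  exists K, forall f : cochain R G n,
    bcochain f -> (forall t, `|f t| <= M) -> `|eval_cochain f c| <= K.
Proof.
move=> lc; have ln : ell1 setT (fun o => M * `|c o|).
  by apply: (ell1_le (ell1Z M lc)) => o _ /=; rewrite !normrM normr_id.
exists (ell1_sum setT (fun o => M * `|c o|)) => f bf fM.
have lf := eval_ell1 bf lc.
have fc o : `|f (repr o) * c o| <= M * `|c o| by rewrite normrM ler_wpM2r.
(* Applied to the integrand and to its negative, this gives the two halves of the estimate. *)
have nn h : (forall o, `|h o| <= M * `|c o|) -> ell1 setT h ->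
    0 <= ell1_sum setT (fun o => M * `|c o|) + ell1_sum setT h.
  move=> hc lh; rewrite -ell1_sumD//; apply: ell1_sum_ge0; last exact: ell1D.
  by move=> o /=; rewrite -lerBlDl sub0r; have := hc o; rewrite ler_norml => /andP[].
rewrite ler_norml -subr_ge0 opprK addrC nn//= -subr_ge0 -ell1_sumN//.
apply: nn => [o|]; first by rewrite normrN.
by apply: (ell1_le lf) => o _ /=; rewrite normrN.
Qed.
Section Slant.
Variables (R : realType) (T : Type) (H : groupType) (q : nat).
Implicit Types F : seq T -> cochain R H q.

Lemma bcochain_lcobound F x : (forall s, bcochain (F s)) ->
  bcochain (fun t => lcobound (F^~ t) x).
Proof.
elim: x F => [|x0 x IHx] F bF; first exact: bcochain0.
have -> : (fun t => lcobound (F^~ t) (x0 :: x) : R^o) =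
    -1 *: (fun t => lcobound ((F \o cons x0)^~ t) x : R^o) + F x.
  by apply/funext => t; rewrite !fctE scaleN1r addrC.
by apply: bcochainL => //; apply: IHx => s; exact: bF.
Qed.

Lemma lcobound_eval (c : ell1_chain R H q) F x :
  ell1 setT c -> (forall s, bcochain (F s)) ->
  lcobound (fun s => eval_cochain (F s) c) x =
  eval_cochain (fun t => lcobound (F^~ t) x) c.
Proof.
move=> lc; elim: x F => [|x0 x IHx] F bF.
  rewrite -[LHS](ell1_sum0 R [set: simplex_orbit H q]); apply: eq_ell1_sum => o _.
  by rewrite /= mul0r.
have bF' s : bcochain ((F \o cons x0) s) by exact: bF.
have -> : (fun t => lcobound (F^~ t) (x0 :: x) : R^o) =
    -1 *: (fun t => lcobound ((F \o cons x0)^~ t) x : R^o) + F x.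
  by apply/funext => t; rewrite !fctE scaleN1r addrC.
rewrite eval_cochainLl//; last exact: bcochain_lcobound.
by rewrite -IHx// mulN1r addrC.
Qed.
End Slant.

(** * Cross products with a detectable cocycle *)

Section CrossProduct.
Variables (R : realType) (G H : groupType).

Definition cross_cochain n p q (f : cochain R G p) (g : cochain R H q) :
    cochain R (G * H)%type n :=
  cup_cochain (pullback_cochain fst f) (pullback_cochain snd g).
Arguments cross_cochain n [p q] f g _.

Lemma seq_cochain_cross n p q (f : cochain R G p) (g : cochain R H q) s :
  n = (p + q)%N ->
  seq_cochain (cross_cochain n f g) s =
  seq_cochain f (take p.+1 (unzip1 s)) * seq_cochain g (drop p (unzip2 s))
    :> R.
Proof.
move=> npq; have [sn|sn] := eqVneq (size s) n.+1; last first.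
  rewrite seq_cochain_size//.
  (* The back part alone detects the length: if it has [q.+1] entries, then [s] has [p + q.+1]. *)
  have [qs|qs] := eqVneq (size (drop p (unzip2 s))) q.+1; last first.
    by rewrite (seq_cochain_size _ qs) mulr0.
  move: qs; rewrite size_drop size_map => qs; case/eqP: sn.
  by rewrite npq -addnS -qs subnKC// ltnW// -subn_gt0 qs.
rewrite -(simplex_seq_nth 1%g sn); set t := fun i => _; rewrite seq_cochainE.
have ple : (p <= n)%N by rewrite npq leq_addr.
rewrite -[unzip1 _]/(map fst _) -[unzip2 _]/(map snd _) -!simplex_seq_comp.
rewrite /cross_cochain /cup_cochain /seq_cochain.
rewrite size_takel ?size_simplex_seq ?ltnS// eqxx.
have -> : size (drop p (simplex_seq (snd \o t))) = q.+1.
  by rewrite size_drop size_simplex_seq npq -addnS addKn.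
rewrite eqxx.
congr (f _ * g _); apply/funext => i.
  by rewrite nth_take// nth_simplex_seq// (leq_trans (ltn_ord i))// ltnS.
by rewrite nth_drop nth_simplex_seq// npq ltnS leq_add2l -ltnS.
Qed.

(** A primitive of the cross product is summed over shuffles and evaluated on [c]. The cycle [c]
    kills the coboundary in the second variable; what remains is a primitive of the normalized [f],
    multiplied by the nonzero [eval_cochain g c]. *)
Lemma cross_bcoboundary n p q (f : cochain R G p) (g : cochain R H q) c :
  n = (p + q)%N -> f \in @bcocycle R G p -> g \in @bcocycle R H q ->
  c \in @ell1_cycle R H q -> eval_cochain g c != 0 ->
  is_bcoboundary (cross_cochain n f g) ->
  is_bcoboundary f.
Proof.
move=> npq Zf Zg Zc gc0 Bfg; have /asboolP[lc _] := Zc; have /asboolP[bg dg] := Zg.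
have [f' [Zf' Bff' f'0]] := normalized_bcocycle Zf.
suff Bf' : is_bcoboundary f'.
  by have := is_bcoboundaryL 1 Bff' Bf'; rewrite scale1r subrK.
have {}Bfg : is_bcoboundary (cross_cochain n f' g).
  have Zsg : (pullback_cochain snd g : cochain R (G * H)%type q)
      \in @bcocycle R (G * H)%type q.
    exact: (pullback_bcocycle snd (BCocycle Zg)).
  have := is_bcoboundary_cupl (is_bcoboundary_pullback fst Bff') Zsg.
  rewrite -npq => B; have := is_bcoboundaryL (-1) B Bfg; congr is_bcoboundary.
  apply/funext => t; rewrite !fctE scaleN1r /cross_cochain /cup_cochain.
  rewrite /pullback_cochain !fctE.
  by rewrite mulrBl opprB subrK.
pose S s := seq_cochain f' (take p.+1 (unzip1 s)) * seq_cochain g (drop p (unzip2 s)).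
(* [B] is a bounded invariant primitive on lists. In degree 0 only 0 is a coboundary, which is
   recorded as [B = fun=> 0]. *)
have [B [BS [M BM] BG Bn]] : exists B : seq (G * H) -> R,
    [/\ lcobound B = S, exists M, forall s, `|B s| <= M,
        forall a s, B (map (lmulg a) s) = B s & n = 0%N -> B = fun=> 0].
  have SE s : S s = seq_cochain (cross_cochain n f' g) s.
    by rewrite seq_cochain_cross.
  case: n npq Bfg SE => [|n] npq /= Bfg SE.
    exists (fun=> 0); split=> //; last by exists 0 => s; rewrite normr0.
    by apply/funext => s; rewrite lcobound0 SE Bfg /seq_cochain; case: ifP.
  have [b bb E] := Bfg; exists (seq_cochain b); split=> //.
  - by apply/funext => s; rewrite lcobound_seq_cochain SE E.
  - exact: seq_cochain_bounded.
  - by move=> a s; exact: seq_cochain_map.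
have BGH a b : B \o map (fun u => (lmulg a u.1, lmulg b u.2)) = B.
  by apply/funext => s /=; rewrite -[RHS](BG (a, b)).
have map1 (K : groupType) (s : seq K) : map (lmulg 1%g) s = s.
  by rewrite -[RHS]map_id; apply: eq_map => z; rewrite mul1g.
(* [B] is invariant under the product group; translating by 1 in one factor gives invariance in each
   variable separately. *)
have BGl a x : shuffle (map (lmulg a) x) B = shuffle x B.
  by apply/funext => y; rewrite -{1}[y]map1 shuffle_map BGH.
have BGr x a y : shuffle x B (map (lmulg a) y) = shuffle x B y.
  by rewrite -{1}[x]map1 shuffle_map BGH.
have bB r x : bcochain (fun y : simplex H r => shuffle x B (simplex_seq y)).
  apply: (@bcochain_simplex_seq _ _ _ (shuffle x B) ((2 ^ (size x + r.+1))%:R * M)).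
    by move=> s <-; exact: shuffle_le.
  exact: BGr.
pose D r x : cochain R H r := fun y => lcobound (shuffle x B) (simplex_seq y).
have BD r x : is_bcoboundary (D r x).
  case: r => [|r].
    apply/funext => y; rewrite /D simplex_seq_cons /simplex_seq enum_ord0 /=.
    by rewrite shuffle_nilr subrr.
  exists (fun y => shuffle x B (simplex_seq y)) => //.
  by apply/funext => y; rewrite coboundary_simplex_seq.
have bD r x : bcochain (D r x).
  apply: (@bcochain_simplex_seq _ _ _ (lcobound (shuffle x B))
           (r.+1%:R * ((2 ^ (size x + r))%:R * M))).
    move=> s sr; rewrite -[X in X%:R * _]sr; apply: lcobound_le => s'.
    by rewrite sr => -[<-]; exact: shuffle_le.
  move=> a s; rewrite lcobound_map; apply: eq_lcobound => s' _.
  exact: BGr.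
pose F x : cochain R H q := fun y => shuffle x B (simplex_seq y).
have bF x : bcochain (F x) by exact: bB.
pose w x := eval_cochain (F x) c.
(* The Leibniz rule at fixed [t]: [shuffle_cross] identifies the left side, and [D] is the
   coboundary in the second variable. *)
have fgE t : f' t *: g = (-1) ^+ p *: D q (simplex_seq t)
    + (fun y => lcobound (F^~ y) (simplex_seq t)).
  apply/funext => y; rewrite !fctE.
  have yN : ~~ nilp (simplex_seq y) by rewrite /nilp size_simplex_seq.
  have := shuffle_cross (seq_cochain g) f'0 (size_simplex_seq t) yN.
  rewrite !seq_cochainE -/S -BS shuffle_lcobound => E.
  rewrite -[LHS]/(f' t * g y) -E size_simplex_seq !exprS mulrA mulN1r opprK mul1r.
  exact: addrC.
have fE t : f' t * eval_cochain g c = lcobound w (simplex_seq t).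
  have := eval_cochainLl (f' t) bg (bcochain0 _ _ _) lc.
  rewrite (eval_bcoboundary (is_bcoboundary0 _ _ _) Zc) [RHS]addr0 => <-.
  rewrite addr0 fgE eval_cochainLl//; last exact: bcochain_lcobound.
  by rewrite (eval_bcoboundary (BD q _) Zc) mulr0 add0r -lcobound_eval.
have {fgE} gcK t : f' t = (eval_cochain g c)^-1 * lcobound w (simplex_seq t).
  by rewrite -fE mulrC mulfK.
have wG a x : w (map (lmulg a) x) = w x by rewrite /w /F BGl.
case: p => [|m] in npq f Zf f' Zf' Bff' f'0 Bfg S BS fE gcK *.
  (* In degree 0 the claim is [f' = 0], so [w [::]] has to vanish. If [q = 0], then [n = 0] and [B]
     is 0; otherwise [shuffle [::] B] is 0 on lists of at least two vertices. *)
  apply/funext => t; rewrite gcK simplex_seq_cons /simplex_seq enum_ord0 /= subr0.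
  rewrite [w [::]](_ : _ = 0) ?mulr0// -[RHS](ell1_sum0 R [set: simplex_orbit H q]).
  apply: eq_ell1_sum => o _; rewrite /F [shuffle _ _ _](_ : _ = 0) ?mul0r//.
  case: q npq {g c Zg Zc gc0 Bfg lc bg dg S BS F bF w fE gcK wG} o => [|q] npq o.
    by rewrite Bn //= simplex_seq_cons /simplex_seq enum_ord0.
  by rewrite 2!simplex_seq_cons.
(* The slant product divided by the pairing. In its bound, the exponent counts the [m.+1] vertices
   of the first and the [q.+1] of the second simplex. *)
exists (fun t => (eval_cochain g c)^-1 * w (simplex_seq t)).
  have [K KP] := eval_cochain_bounded ((2 ^ (m.+1 + q.+1))%:R * M) lc.
  apply: (@bcochain_simplex_seq _ _ _ (fun s => (eval_cochain g c)^-1 * w s)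
            (`|(eval_cochain g c)^-1| * K)).
    move=> s sm; rewrite normrM ler_wpM2l//; apply: KP => // y.
    by rewrite -sm -(size_simplex_seq y); exact: shuffle_le.
  by move=> a s; rewrite wG.
apply/funext => t; rewrite gcK -lcoboundZ.
exact/esym/(coboundary_simplex_seq (fun s => (eval_cochain g c)^-1 * w s)).
Qed.
End CrossProduct.

(** * A nonzero class in the kernel, and the consequence for [Lex] *)

Theorem theoremA4 (R : realType) (L1 L2 L3 : groupType) (n n1 n2 n3 : nat)
    (phi1 : bcohomology R L1 n1) (phi2 : bcohomology R L2 n2)
    (phi3 : bcohomology R L3 n3) :
  (n1 + n2 + n3 = n)%N ->
  ell1_detectable phi1 -> ell1_detectable phi2 -> ell1_detectable phi3 ->
  cup (bcohomology_map (freeprod_proj1 L1 L2) phi1)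
      (bcohomology_map (freeprod_proj2 L1 L2) phi2) = 0 ->
  ~ injective (@bcohomology_map R (freeprod L1 L2 * L3)%type
                 ((L1 * L2) * L3)%type (freeprod_to_prod L1 L2 L3) n) /\
  ~ Lex R ((L1 * L2) * L3)%type.
Proof.
move=> <- [y1 det1] [y2 det2] [y3 det3] cup0.
have ninj : ~ injective (@bcohomology_map R (freeprod L1 L2 * L3)%type
    ((L1 * L2) * L3)%type (freeprod_to_prod L1 L2 L3) (n1 + n2 + n3)).
  move=> inj; move: cup0 det1 det2 det3; rewrite /ell1_pairing /bcohomology_map cup_pi.
  set z1 := repr phi1; set z2 := repr phi2; set z3 := repr phi3.
  move=> /lmod_quot_pi0/asboolP B12 det1 det2 det3.
  pose z12 := cup_bcocycle (bcocycle_map fst z1) (bcocycle_map snd z2).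
  pose z := cup_bcocycle (bcocycle_map fst z12) (bcocycle_map snd z3).
  have /lmod_quot_pi0/asboolP Bz : (\pi_(bcohomology R _ _) z)%qT = 0.
    apply: inj; rewrite linear0 bcohomology_map_pi.
    apply/lmod_quot_pi0/asboolP.
    (* By conversion, the pullback of [z] is the cup product of the coboundary in [B12], pulled back
       along [fst], with the pullback of [z3] along [snd]. *)
    exact: is_bcoboundary_cupl (is_bcoboundary_pullback fst B12)
             (pullback_bcocycle snd z3).
  (* Removing [z3] and then [z2], each detected by its cycle, leaves [z1] as a coboundary. *)
  have B12' := cross_bcoboundary erefl (valP z12) (valP z3) (valP (repr y3)) det3 Bz.
  have B1 := cross_bcoboundary erefl (valP z1) (valP z2) (valP (repr y2)) det2 B12'.
  by move: det1; rewrite (eval_bcoboundary B1 (valP _)) eqxx.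
split=> // lex; apply: ninj; apply: lex => -[[a b] c].
(* Each projection kills the letter of the other factor, so the product of [a] and [b] maps to the
   pair [(a, b)]. *)
pose x := (freeprod_inl L2 a * freeprod_inr L1 b)%g; exists (x, c).
rewrite -[LHS]/((freeprod_proj1 L1 L2 x, freeprod_proj2 L1 L2 x), c) !gmulfM.
by rewrite /= !freeprod_lift_inl !freeprod_lift_inr /= mulg1 mul1g.
Qed.
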